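(* Let $\nu,\rho,\alpha>0$ satisfy $$\frac{3d}{2}\rho^2<\alpha,\qquad \frac{d\rho^2}{1+2\rho\nu}<\alpha.$$ Let $x_h^*\in\mathcal{H}_h$ be a fixed point of $G$, i.e. $G(x_h^* )=x_h^*$, and let $\mathcal{U}\subset\mathcal{H}_h$ be a bounded neighborhood of $x_h^*$. Then there exist constants $C_0(\mathcal{U})>0$ and $C_1(\mathcal{U})>0$ such that for all $x,\widetilde{x}\in\mathcal{U}$ and all $y\in\mathcal{H}_h$, $$\|G'(x)y\|_{\mathcal{H}_h}\le C_0(\mathcal{U})\,\|y\|_{\mathcal{H}_h}$$ and $$\|G'(x)y-G'(\widetilde{x})y\|_{\mathcal{H}_h}\le C_1(\mathcal{U})\,\|x-\widetilde{x}\|_{\mathcal{H}_h}\,\|y\|_{\mathcal{H}_h}.$$ Thus $G$ is continuously Fréchet differentiable with derivative $G'$, has the fixed point $x_h^*$, and satisfies these two bounds locally on $\mathcal{U}$.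
   Context: Let $d\in\{2,3\}$ and let $\Omega\subset\mathbb{R}^d$ be a bounded domain with Lipschitz boundary. $(\cdot,\cdot)$ and $\|\cdot\|$ denote the $L^2(\Omega)$ inner product and norm (for scalar, vector or matrix fields). Put $\mathbf{X}=[H_0^1(\Omega)]^d$ and $Q=L^2_0(\Omega)=\{q\in L^2(\Omega):\int_\Omega q=0\}$. Let $\mathbf{f}\in \mathbf{X}'$ (the dual of $\mathbf{X}$), write $(\mathbf{f},\mathbf{v})$ for the duality pairing, and let $\|\mathbf{f}\|_{-1}=\sup_{0\neq\mathbf{v}\in\mathbf{X}}|(\mathbf{f},\mathbf{v})|/\|\nabla\mathbf{v}\|$. Let $\mathbf{X}_h\subset\mathbf{X}$ and $Q_h\subset Q$ be finite-dimensional (finite element) subspaces. Skew-symmetric trilinear form: $b^*(\mathbf{u},\mathbf{v},\mathbf{w})=\tfrac12((\mathbf{u}\cdot\nabla)\mathbf{v},\mathbf{w})-\tfrac12((\mathbf{u}\cdot\nabla)\mathbf{w},\mathbf{v})$ for $\mathbf{u},\mathbf{v},\mathbf{w}\in\mathbf{X}$. It satisfies the standard (known) continuity bound $|b^*(\mathbf{u},\mathbf{v},\mathbf{w})|\le\mathcal{M}\|\nabla\mathbf{u}\|\|\nabla\mathbf{v}\|\|\nabla\mathbf{w}\|$ with $\mathcal{M}=\sup_{\mathbf{u},\mathbf{v},\mathbf{w}\in\mathbf{X}\setminus\{0\}}\frac{|(\mathbf{u}\cdot\nabla\mathbf{v},\mathbf{w})|}{\|\nabla\mathbf{u}\|\|\nabla\mathbf{v}\|\|\nabla\mathbf{w}\|}<\infty$.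 Product space and norm: $\mathcal{H}_h=\mathbf{X}_h\times Q_h$, $\|(\mathbf{v}_h,q_h)\|_{\mathcal{H}_h}=(\|\nabla\mathbf{v}_h\|^2+\alpha\|q_h\|^2)^{1/2}$. Operator $G:\mathcal{H}_h\to\mathcal{H}_h$: for $(\mathbf{u}_h,p_h)\in\mathcal{H}_h$, $G(\mathbf{u}_h,p_h)=(\mathbf{U}_h,P_h)$, with $\mathbf{U}_h=G_1(\mathbf{u}_h,p_h)$ and $P_h=G_2(\mathbf{u}_h,p_h)$, is the unique pair in $\mathcal{H}_h$ such that, for all $(\mathbf{v}_h,q_h)\in\mathbf{X}_h\times Q_h$, $$\tfrac1\rho(\nabla(\mathbf{U}_h-\mathbf{u}_h),\nabla\mathbf{v}_h)+\nu(\nabla\mathbf{U}_h,\nabla\mathbf{v}_h)+b^*(\mathbf{u}_h,\mathbf{U}_h,\mathbf{v}_h)+\tfrac{\rho}{\alpha}(\nabla\cdot\mathbf{U}_h,\nabla\cdot\mathbf{v}_h)-(p_h,\nabla\cdot\mathbf{v}_h)=(\mathbf{f},\mathbf{v}_h),$$ $$\alpha(P_h-p_h,q_h)+\rho(\nabla\cdot\mathbf{U}_h,q_h)=0.$$ Operator $G'$: for $x=(\mathbf{u}_h,p_h)\in\mathcal{H}_h$ and $y=(\mathbf{w}_h,s_h)\in\mathcal{H}_h$, $G'(x)y=(\mathbf{D}_h,E_h)$ is the unique pair in $\mathcal{H}_h$ such that, for all $(\mathbf{v}_h,q_h)\in\mathbf{X}_h\times Q_h$, $$(\nabla(\mathbf{D}_h-\mathbf{w}_h),\nabla\mathbf{v}_h)+\rho\nu(\nabla\mathbf{D}_h,\nabla\mathbf{v}_h)+\rho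 b^*(\mathbf{u}_h,\mathbf{D}_h,\mathbf{v}_h)+\rho b^*(\mathbf{w}_h,G_1(\mathbf{u}_h,p_h),\mathbf{v}_h)+\tfrac{\rho^2}{\alpha}(\nabla\cdot\mathbf{D}_h,\nabla\cdot\mathbf{v}_h)-\rho(s_h,\nabla\cdot\mathbf{v}_h)=0,$$ $$\alpha(E_h-s_h,q_h)+\rho(\nabla\cdot\mathbf{D}_h,q_h)=0.$$ *)

(* Defs.v *)
From HB Require Import structures.
From mathcomp Require Import all_boot all_order all_algebra.
From mathcomp Require Import generic_quotient ring_quotient.
From mathcomp Require Import all_classical all_reals all_analysis.
From mathcomp Require Import measurable_realfun lebesgue_integral_fubini.

Set Implicit Arguments.
Unset Strict Implicit.
Unset Printing Implicit Defensive.

Import Order.TTheory GRing.Theory Num.Theory.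
Import numFieldNormedType.Exports.

Local Open Scope classical_set_scope.
Local Open Scope ring_scope.

Definition rV_display : measure_display. Proof. exact: default_measure_display. Qed.

Section measurable_rV.
Context (R : realType) (n : nat).

Let coord (i : 'I_n) (x : 'rV[R]_n) : measurableTypeR R := x ord0 i.

Let rV_set0 : g_sigma_preimage coord set0.
Proof. exact: sigma_algebra0. Qed.

Let rV_setC A : g_sigma_preimage coord A -> g_sigma_preimage coord (~` A).
Proof. exact: sigma_algebraC. Qed.

Let rV_bigcup (F : (set 'rV[R]_n)^nat) :
  (forall i, g_sigma_preimage coord (F i)) ->
  g_sigma_preimage coord (\bigcup_i (F i)).
Proof. exact: sigma_algebra_bigcup. Qed.

(* The sigma-algebra generated by the coordinates is the Borel one: open sets
   belong to it (open_measurable_rV) and coordinates are continuous. *)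
HB.instance Definition _ := @isMeasurable.Build rV_display
  'rV[R]_n (g_sigma_preimage coord) rV_set0 rV_setC rV_bigcup.

End measurable_rV.

Section rV_lemmas.
Context (R : realType).

Lemma measurable_rV_coord n (i : 'I_n) :
  measurable_fun [set: 'rV[R]_n] (fun x : 'rV[R]_n => x ord0 i : measurableTypeR R).
Proof.
move=> _ Y mY; rewrite setTI; apply: sub_sigma_algebra => /=.
rewrite -bigcup_seq/=; exists i => /=; first by rewrite mem_index_enum.
by exists Y => //; rewrite setTI.
Qed.

Lemma measurable_fun_rV d (T : measurableType d) n (f : T -> 'rV[R]_n) :
  (forall i, measurable_fun [set: T] (fun x => f x ord0 i : measurableTypeR R)) ->
  measurable_fun [set: T] f.
Proof.
move=> mf _ A mA; rewrite setTI.
move: A mA; apply: smallest_sub.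
  split => /=.
  - by rewrite preimage_set0; exact: measurable0.
  - by move=> A mA; rewrite setTD preimage_setC; exact: measurableC.
  - by move=> F mF; rewrite preimage_bigcup; exact: bigcup_measurable.
move=> A; rewrite -bigcup_seq/= => -[i _ [B mB <-]]; rewrite setTI.
by have := mf i measurableT B mB; rewrite setTI.
Qed.

Definition rV_cons n (x : measurableTypeR R * 'rV[R]_n) : 'rV[R]_n.+1 :=
  row_mx (const_mx x.1 : 'rV[R]_1) x.2.

Lemma measurable_rV_cons n : measurable_fun setT (@rV_cons n).
Proof.
apply: measurable_fun_rV => i.
have -> : (fun x => rV_cons x ord0 i : measurableTypeR R) =
    match fintype.split (i : 'I_(1 + n)) with
    | inl _ => fst
    | inr j => (fun y : 'rV[R]_n => y ord0 j : measurableTypeR R) \o snd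
    end.
  apply/funext => x; rewrite /rV_cons mxE.
  by case: fintype.split => j //=; rewrite mxE.
case: fintype.split => j //.
by apply: measurableT_comp => //; exact: measurable_rV_coord.
Qed.

Section lebesgue_rV_step.
Local Open Scope ereal_scope.
Context (n : nat) (m : {sigma_finite_measure set 'rV[R]_n -> \bar R}).

Definition lebesgue_rV_step : set 'rV[R]_n.+1 -> \bar R :=
  pushforward ((@lebesgue_measure R) \x m) (@rV_cons n).

Let step0 : lebesgue_rV_step set0 = 0.
Proof. by rewrite /lebesgue_rV_step /pushforward preimage_set0 measure0. Qed.

Let step_ge0 A : 0 <= lebesgue_rV_step A.
Proof. by rewrite /lebesgue_rV_step /pushforward; apply: measure_ge0. Qed.

Let step_sigma_additive : semi_sigma_additive lebesgue_rV_step.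
Proof.
move=> F mF tF mUF; rewrite /lebesgue_rV_step /pushforward preimage_bigcup.
have mp A : measurable A -> measurable (@rV_cons n @^-1` A).
  by move=> mA; rewrite -[X in measurable X]setTI; exact: measurable_rV_cons.
apply: measure_semi_sigma_additive.
- by move=> k; exact: mp.
- apply/trivIsetP => /= i j _ _ ij; rewrite -preimage_setI.
  by move/trivIsetP : tF => /(_ _ _ _ _ ij) ->//; rewrite preimage_set0.
- by rewrite -preimage_bigcup; exact: mp.
Qed.

HB.instance Definition _ := isMeasure.Build _ _ _ lebesgue_rV_step
  step0 step_ge0 step_sigma_additive.

Let step_sigma_finite : sigma_finite setT lebesgue_rV_step.
Proof.
have /sigma_finiteP[F [FT ndF Foo]] := sigma_finiteT (@lebesgue_measure R).
have /sigma_finiteP[G [GT ndG Goo]] := sigma_finiteT m.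
pose tail (x : 'rV[R]_n.+1) : measurableTypeR R * 'rV[R]_n :=
  (x ord0 ord0, \row_j x ord0 (lift ord0 j)).
have mtail : measurable_fun setT tail.
  apply/measurable_fun_pairP; split; first exact: measurable_rV_coord.
  apply: measurable_fun_rV => j.
  rewrite (_ : (fun _ => _) = fun x : 'rV[R]_n.+1 => x ord0 (lift ord0 j)).
    exact: measurable_rV_coord.
  by apply/funext => x /=; rewrite mxE.
have consK : cancel (@rV_cons n) tail.
  move=> [a y]; congr pair.
    rewrite /= /rV_cons (_ : ord0 = lshift n (ord0 : 'I_1)); last exact/val_inj.
    by rewrite (@row_mxEl _ _ 1 n) mxE.
  apply/rowP => j; rewrite mxE /= /rV_cons.
  rewrite (_ : lift ord0 j = rshift 1 j); last exact/val_inj.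
  by rewrite (@row_mxEr _ _ 1 n).
exists (fun k => tail @^-1` (F k `*` G k)).
  rewrite -preimage_bigcup (_ : \bigcup_k _ = setT) ?preimage_setT//.
  rewrite -setXTT FT GT predeqE => -[x y]; split.
    by move=> [k _ []/= ? ?]; split; exists k.
  move=> [/= [i _ Fix_] [k _ Gky]]; exists (maxn i k) => //; split.
  - by move: x Fix_; exact/subsetPset/ndF/leq_maxl.
  - by move: y Gky; exact/subsetPset/ndG/leq_maxr.
move=> k; have [mF Fk] := Foo k; have [mG Gk] := Goo k; split.
  by rewrite -[X in measurable X]setTI; apply: mtail => //; exact: measurableX.
rewrite /lebesgue_rV_step /pushforward -comp_preimage.
rewrite (_ : tail \o _ = id); last by apply/funext => x /=; rewrite consK.
by rewrite preimage_id product_measure1E// lte_mul_pinfty// ge0_fin_numE.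
Qed.

HB.instance Definition _ := Measure_isSigmaFinite.Build _ _ _ lebesgue_rV_step
  step_sigma_finite.

End lebesgue_rV_step.

(* Iterated product of the Lebesgue measure on R, transported along rV_cons;
   see lebesgue_rV_box for its value on boxes. *)
Fixpoint lebesgue_rV n : {sigma_finite_measure set 'rV[R]_n -> \bar R} :=
  match n with
  | 0 => \d_(0 : 'rV[R]_0)
  | k.+1 => lebesgue_rV_step (lebesgue_rV k)
  end.

End rV_lemmas.

Lemma open_measurable_rV (R : realType) n (U : set 'rV[R]_n) :
  open U -> measurable U.
Proof.
move=> oU.
pose box (p : 'rV[rat]_n * nat) : set 'rV[R]_n :=
  [set x | forall i, ball (ratr (p.1 ord0 i) : R) p.2.+1%:R^-1 (x ord0 i)].
have mbox p : measurable (box p).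
  rewrite (_ : box p = \big[setI/setT]_(i < n)
      [set x : 'rV[R]_n | ball (ratr (p.1 ord0 i) : R) p.2.+1%:R^-1 (x ord0 i)]).
    apply: bigsetI_measurable => i _.
    rewrite -[X in measurable X]setTI.
    by apply: (@measurable_rV_coord R n i) => //; exact: measurable_ball.
  rewrite -bigcap_seq; apply/seteqP; split=> [x bx i _|x bx i]; first exact: bx.
  by apply: (bx i); rewrite /= mem_index_enum.
have -> : U = \bigcup_(p in [set p | box p `<=` U]) box p.
  apply/seteqP; split=> [x Ux|x [p pU px]]; last exact: pU.
  have /nbhs_ballP[e /= e0 eU] : nbhs x U by exact: open_nbhs_nbhs.
  pose k := Num.truncn (2 / e).
  have ke : 2 / e < k.+1%:R by exact: truncnS_gt.
  have k0 : 0 < k.+1%:R^-1 :> R by rewrite invr_gt0.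
  have /choice[q qP] : forall i : 'I_n, exists r : rat,
      ball (x ord0 i) k.+1%:R^-1 (ratr r : R).
    move=> i; have [|r] := @rat_in_itvoo R (x ord0 i) (x ord0 i + k.+1%:R^-1).
      by rewrite ltrDl.
    rewrite in_itv /= => /andP[r1 r2]; exists r.
    rewrite /ball /= distrC gtr0_norm ?subr_gt0//.
    by rewrite ltrBlDl.
  exists (\row_i q i, k); last first.
    by move=> i /=; rewrite mxE; exact/ball_sym/qP.
  move=> y yP; apply: eU; split=> // i j; rewrite (ord1 i).
  have := yP j; rewrite /= mxE => yj.
  have : ball (x ord0 j) (k.+1%:R^-1 + k.+1%:R^-1) (y ord0 j).
    exact: ball_triangle (qP j) yj.
  apply: le_ball.
  have -> : k.+1%:R^-1 + k.+1%:R^-1 = 2 / k.+1%:R :> R by rewrite mulrDl mul1r.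
  by rewrite ler_pdivrMr ?ltr0n// mulrC -ler_pdivrMr// ltW.
rewrite bigcup_mkcond.
apply: countable_bigcupT_measurable; first exact: countableP.
by move=> p; case: ifPn.
Qed.

Lemma lebesgue_rV_box (R : realType) n (A : 'I_n -> set (measurableTypeR R)) :
  (forall i, measurable (A i)) ->
  (lebesgue_rV R n [set x | forall i, A i (x ord0 i)] =
   \prod_(i < n) lebesgue_measure (A i))%E.
Proof.
elim: n A => [|n IH] A mA.
  by rewrite big_ord0 /= diracE mem_set// => -[].
rewrite big_ord_recl /= -IH// /lebesgue_rV_step /pushforward.
rewrite (_ : _ @^-1` _ =
    A ord0 `*` [set y : 'rV[R]_n | forall i, A (lift ord0 i) (y ord0 i)]).
  rewrite product_measure1E//.
  rewrite (_ : [set y | _] = \bigcap_(i in [set` index_enum 'I_n])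
      [set y : 'rV[R]_n | A (lift ord0 i) (y ord0 i)]).
    rewrite bigcap_seq; apply: bigsetI_measurable => i _.
    by rewrite -[X in measurable X]setTI; exact: measurable_rV_coord.
  apply/seteqP; split=> [y yA i _|y yA i]; first exact: yA.
  by apply: (yA i); rewrite /= mem_index_enum.
have cons0 x : @rV_cons R n x ord0 ord0 = x.1.
  rewrite /rV_cons (_ : ord0 = lshift n (ord0 : 'I_1)); last exact/val_inj.
  by rewrite (@row_mxEl _ _ 1 n) mxE.
have consS x i : @rV_cons R n x ord0 (lift ord0 i) = x.2 ord0 i.
  rewrite /rV_cons (_ : lift ord0 i = rshift 1 i); last exact/val_inj.
  by rewrite (@row_mxEr _ _ 1 n).
apply/seteqP; split=> [[a y] /= h|[a y] /= [h0 h] i].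
  split; first by have := h ord0; rewrite cons0.
  by move=> i; have := h (lift ord0 i); rewrite consS.
by case: (unliftP ord0 i) => [j|] ->; rewrite ?cons0 ?consS.
Qed.

Section L2_space.
Context d (T : measurableType d) (R : realType) (mu : {measure set T -> \bar R}).

Local Notation L2fun := (LfunType mu (lee1n 2)).

Definition ae_zero : {pred L2fun} := fun f => `[< (f : T -> R) = cst 0 %[ae mu] >].

Lemma ae_zeroP (f : L2fun) : reflect ({ae mu, forall x, f x = 0}) (f \in ae_zero).
Proof.
rewrite /in_mem /= /ae_zero; apply: (iffP (asboolP _)).
  by apply: filterS => x /(_ I).
by apply: filterS => x h _.
Qed.

Lemma ae_zero_zmod_closed : zmod_closed ae_zero.
Proof.
split; first by apply/ae_zeroP; apply: nearW.
move=> f g /ae_zeroP f0 /ae_zeroP g0; apply/ae_zeroP.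
apply: filterS2 f0 g0 => x fx gx; rewrite -[LHS]/(f x - g x).
by rewrite fx gx subrr.
Qed.

HB.instance Definition _ := GRing.isZmodClosed.Build _ ae_zero ae_zero_zmod_closed.

(* The library's LspaceType has no module structure, hence this quotient of
   LfunType by the functions that vanish almost everywhere. *)
Definition L2 : Type := @Quotient.quot _ ae_zero.
HB.instance Definition _ := GRing.Zmodule.on L2.

Definition L2_class (f : L2fun) : L2 := \pi_(@Quotient.quot _ ae_zero)%qT f.
Definition L2_repr (u : L2) : L2fun := @repr _ (@Quotient.quot _ ae_zero) u.
Definition L2_fun (u : L2) : T -> R := L2_repr u.

Lemma L2_reprK u : L2_class (L2_repr u) = u.
Proof. exact: (@reprK _ (@Quotient.quot _ ae_zero)). Qed.

Lemma L2_classP f g :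
  L2_class f = L2_class g <-> {ae mu, forall x, f x = g x}.
Proof.
have fgE : (L2_class f = L2_class g) <-> (f - g \in ae_zero).
  by rewrite Quotient.idealrBE; split=> [/eqP|/eqP].
rewrite fgE; split=> [/ae_zeroP|] h.
  by apply: filterS h => x /eqP; rewrite -[_ x]/(f x - g x) subr_eq0 => /eqP.
apply/ae_zeroP; apply: filterS h => x fg.
by rewrite -[LHS]/(f x - g x) fg subrr.
Qed.

Lemma L2_classD f g : L2_class (f + g) = L2_class f + L2_class g.
Proof. by rewrite /L2_class; exact: (raddfD (\pi_(@Quotient.quot _ ae_zero)%qT)). Qed.

Lemma L2_fun_class f : {ae mu, forall x, L2_fun (L2_class f) x = f x}.
Proof. by apply/L2_classP; rewrite L2_reprK. Qed.

Definition L2_scale (a : R) (u : L2) : L2 := L2_class (a *: L2_repr u).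

Lemma L2_scale_class a f : L2_scale a (L2_class f) = L2_class (a *: f).
Proof.
apply/L2_classP; apply: filterS (L2_fun_class f) => x fx.
by rewrite -[LHS]/(a * L2_fun (L2_class f) x) fx.
Qed.

Let L2_scaleA a b u : L2_scale a (L2_scale b u) = L2_scale (a * b) u.
Proof. by rewrite -[u]L2_reprK !L2_scale_class scalerA. Qed.

Let L2_scale1 : left_id 1 L2_scale.
Proof. by move=> u; rewrite -[u]L2_reprK L2_scale_class scale1r. Qed.

Let L2_scaleDr : right_distributive L2_scale +%R.
Proof.
move=> a u v; rewrite -[u]L2_reprK -[v]L2_reprK -L2_classD !L2_scale_class.
by rewrite scalerDr L2_classD.
Qed.

Let L2_scaleDl u : {morph L2_scale^~ u : a b / a + b}.
Proof.
by move=> a b; rewrite -[u]L2_reprK !L2_scale_class scalerDl L2_classD.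
Qed.

HB.instance Definition _ := GRing.Zmodule_isLmodule.Build R L2
  L2_scaleA L2_scale1 L2_scaleDr L2_scaleDl.

Definition L2_ip (u v : L2) : R := \int[mu]_x (L2_fun u x * L2_fun v x).
End L2_space.

Coercion L2_fun : L2 >-> Funclass.

Section function_spaces.
Context (R : realType) (d : nat) (Omega : set 'rV[R]_d) (oOmega : open Omega).
Implicit Types (phi : 'rV[R]_d -> R) (i : 'I_d).

Definition bounded_domain : Prop :=
  [/\ Omega !=set0, connected Omega & bounded_set Omega].

(* Near each boundary point, Omega is the strict epigraph of a Lipschitz
   function in the orthonormal coordinates y *m A, the k-th one being vertical. *)
Definition lipschitz_boundary : Prop :=
  forall x, (closure Omega `\` Omega) x ->
  exists (A : 'M[R]_d) (k : 'I_d) (gamma : 'rV[R]_d.-1 -> R) (L r : R),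
    [/\ A *m A^T = 1%:M, L.-lipschitz gamma, 0 < r &
      forall y, ball x r y ->
        (Omega y <-> gamma (col' k (y *m A)) < (y *m A) ord0 k)].

Definition dx : {measure set 'rV[R]_d -> \bar R} :=
  mrestr (lebesgue_rV R d) (open_measurable_rV oOmega).

Local Notation L2 := (L2 dx).

Definition partial i phi : 'rV[R]_d -> R := fun x => 'D_(delta_mx ord0 i) phi x.

Fixpoint Cn (n : nat) phi : Prop :=
  continuous phi /\
  match n with
  | 0 => True
  | m.+1 => forall i, (forall x, derivable phi x (delta_mx ord0 i)) /\
                      Cn m (partial i phi)
  end.

Definition test_function phi : Prop :=
  let K := closure [set x | phi x != 0] in
  [/\ forall n, Cn n phi, compact K & K `<=` Omega].

Definition weak_gradient (u : L2) (g : 'I_d -> L2) : Prop :=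
  forall phi i, test_function phi ->
    \int[dx]_x (u x * partial i phi x) = - \int[dx]_x (g i x * phi x).

(* A function of H^1 is stored with its weak gradient, as a pair (u, g); H10 is
   the closure of the test functions in the H^1 norm. *)
Definition H1_pair := (L2 * ('I_d -> L2))%type.

Definition H1 : set H1_pair := [set u | weak_gradient u.1 u.2].

Definition H10 : set H1_pair := [set u | H1 u /\
  exists phi : nat -> 'rV[R]_d -> R,
  [/\ forall n, test_function (phi n),
      \int[dx]_x ((u.1 x - phi n x) ^+ 2) @[n --> \oo] --> 0 &
      forall i, \int[dx]_x ((u.2 i x - partial i (phi n) x) ^+ 2) @[n --> \oo]
                --> 0]].

(* A vector field u gives for each i the pair of u_i and its weak gradient. *)
Definition vfield := 'I_d -> H1_pair.
HB.instance Definition _ := GRing.Lmodule.on vfield.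

Definition velocity_space : set vfield := [set u | forall i, H10 (u i)].

Definition pressure_space : set L2 := [set q | \int[dx]_x q x = 0].

Definition component (u : vfield) i : L2 := (u i).1.
(* grad u i j is the j-th partial derivative of the i-th component *)
Definition grad (u : vfield) i j : L2 := (u i).2 j.
Definition divergence (u : vfield) : L2 := \sum_i grad u i i.

Definition grad_ip (u v : vfield) : R :=
  \sum_i \sum_j L2_ip (grad u i j) (grad v i j).
Definition grad_norm (u : vfield) : R := Num.sqrt (grad_ip u u).

Definition convection (u v w : vfield) : R :=
  \int[dx]_x \sum_i (\sum_j component u j x * grad v i j x) * component w i x.

Definition bstar (u v w : vfield) : R :=
  2^-1 * convection u v w - 2^-1 * convection u w v.

Definition velocity_dual (f : vfield -> R) : Prop :=
  (forall a u v, velocity_space u -> velocity_space v -> f (a *: u + v) = a * f u + f v) /\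
  exists C, forall u, velocity_space u -> `|f u| <= C * grad_norm u.

End function_spaces.

Definition fin_dim_subspace (R : realType) (V : lmodType R) (E : set V) : Prop :=
  exists n (e : 'I_n -> V),
    E = [set \sum_i c i *: e i | c in [set: 'I_n -> R]].

Section normed_subspace_calculus.
Context (R : realType) (V : lmodType R) (E : set V) (N : V -> R).

Definition bounded_neighborhood (x0 : V) (U : set V) : Prop :=
  [/\ U `<=` E,
      exists2 e : R, 0 < e & forall x, E x -> N (x - x0) < e -> U x &
      exists M : R, forall x, U x -> N x <= M].

Definition bounded_linear_on (L : V -> V) : Prop :=
  [/\ forall y, E y -> E (L y),
      forall (a : R) y z, E y -> E z -> L (a *: y + z) = a *: L y + L z &
      exists C : R, forall y, E y -> N (L y) <= C * N y].

Definition frechet_derivative_at (F : V -> V) (x : V) (L : V -> V) : Prop :=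
  bounded_linear_on L /\
  forall e : R, 0 < e -> exists2 r : R, 0 < r &
    forall y, E y -> N y < r -> N (F (x + y) - F x - L y) <= e * N y.

(* The second clause is continuity of x |-> dF x for the operator norm. *)
Definition continuously_frechet_differentiable
    (F : V -> V) (dF : V -> V -> V) : Prop :=
  (forall x, E x -> frechet_derivative_at F x (dF x)) /\
  forall x, E x -> forall e : R, 0 < e -> exists2 r : R, 0 < r &
    forall z, E z -> N (z - x) < r ->
    forall y, E y -> N (dF z y - dF x y) <= e * N y.

End normed_subspace_calculus.

Section operators.
Context (R : realType) (d : nat) (Omega : set 'rV[R]_d) (oOmega : open Omega).
Variables (nu rho alpha : R) (f : vfield oOmega -> R).
Variables (Xh : set (vfield oOmega)) (Qh : set (L2 (dx oOmega))).

Definition state := (vfield oOmega * L2 (dx oOmega))%type.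
HB.instance Definition _ := GRing.Lmodule.on state.

Implicit Types x y : state.

Definition Hh : set state := [set x | Xh x.1 /\ Qh x.2].

Definition Hh_norm x : R :=
  Num.sqrt (grad_norm x.1 ^+ 2 + alpha * L2_ip x.2 x.2).

Definition G_equations x y : Prop :=
  (forall v, Xh v ->
     rho^-1 * grad_ip (y.1 - x.1) v + nu * grad_ip y.1 v + bstar x.1 y.1 v
     + rho / alpha * L2_ip (divergence y.1) (divergence v)
     - L2_ip x.2 (divergence v) = f v) /\
  (forall q, Qh q ->
     alpha * L2_ip (y.2 - x.2) q + rho * L2_ip (divergence y.1) q = 0).

(* G x (resp. G' x y) is the element of Hh that solves the equations; the
   default value 0 would only be returned if there were no solution. *)
Definition G x : state := xget 0 [set y | Hh y /\ G_equations x y].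

Definition G'_equations x y z : Prop :=
  (forall v, Xh v ->
     grad_ip (z.1 - y.1) v + rho * nu * grad_ip z.1 v
     + rho * bstar x.1 z.1 v + rho * bstar y.1 (G x).1 v
     + rho ^+ 2 / alpha * L2_ip (divergence z.1) (divergence v)
     - rho * L2_ip y.2 (divergence v) = 0) /\
  (forall q, Qh q ->
     alpha * L2_ip (z.2 - y.2) q + rho * L2_ip (divergence z.1) q = 0).

Definition G' x y : state := xget 0 [set z | Hh z /\ G'_equations x y z].

End operators.

(* Main.v *)
Require Import Defs.
From mathcomp Require Import all_boot all_order all_algebra.
From mathcomp Require Import all_classical all_reals all_analysis.
From mathcomp Require Import measurable_realfun.
From mathcomp Require Import ring lra.

Import Order.TTheory GRing.Theory Num.Theory.
Import numFieldNormedType.Exports.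

Local Open Scope classical_set_scope.
Local Open Scope ring_scope.

(* Both bounds and the differentiability of G come from one coercivity estimate.  Since b*(u,v,v) = 0, the
   Oseen form a_u(U,v) = (1/rho + nu)(grad U, grad v) + b*(u,U,v)
   + (rho/alpha)(div U, div v) satisfies a_u(U,U) >= (1/rho + nu)|grad U|^2
   whatever u is; on a finite-dimensional space this yields existence, uniqueness
   and a bound for every right-hand side.  The equations of G and (after division
   by rho) of G' are Oseen problems, and so are the equations of the increments
   G x - G x', G' x y - G' x' y and of the remainder G (x + y) - G x - G' x y;
   the bound M|grad u||grad v||grad w| on b* turns their right-hand sides into the
   claimed estimates, with constants that only depend on |grad G_1(x)|.

   The bound on b* rests on the embedding of H^1_0 in L^4 for d = 2, 3.  For a test
   function, phi^2 <= int |2 phi d_i phi| along each line parallel to an axis; this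
   gives Poincare's inequality and Ladyzhenskaya's inequality
   int phi^4 <= int |2 phi d_1 phi| * int |2 phi d_2 phi| in the plane, and slicing
   space by planes gives the case d = 3.  Both pass to H^1_0 by density, the second
   one through the truncations min(|u|, k), which avoids extracting subsequences. *)

Set Implicit Arguments.
Unset Strict Implicit.
Unset Printing Implicit Defensive.

(** * Inner products *)

Section semi_inner_product.
Context (R : realType) (V : lmodType R) (ip : V -> V -> R).
Hypothesis ip_linear : forall a u v w, ip (a *: u + v) w = a * ip u w + ip v w.
Hypothesis ipC : forall u v, ip u v = ip v u.
Hypothesis ip_ge0 : forall u, 0 <= ip u u.
Implicit Types u v w : V.

Lemma ip_linearr a u v w : ip w (a *: u + v) = a * ip w u + ip w v.
Proof. by rewrite ipC ip_linear !(ipC w). Qed.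

Lemma semi_ip_sqr a u v :
  ip (a *: u + v) (a *: u + v) = a ^+ 2 * ip u u + 2 * a * ip u v + ip v v.
Proof. rewrite ip_linear !ip_linearr (ipC v u); ring. Qed.

(** The quadratic [t |-> ip (t *: u + v) (t *: u + v)] is nonnegative; it is evaluated at its
    minimiser or, when [ip u u = 0] makes it affine, at the point where it would equal -1.
    Definiteness is not assumed because the gradient form does not see the function values stored in
    a field. *)
Lemma semi_ip_cauchy_schwarz u v : `|ip u v| <= Num.sqrt (ip u u) * Num.sqrt (ip v v).
Proof.
rewrite -sqrtrM// -sqrtr_sqr ler_wsqrtr//.
have H t : 0 <= t ^+ 2 * ip u u + 2 * t * ip u v + ip v v.
  by rewrite -semi_ip_sqr.
have [u0|u0] := eqVneq (ip u u) 0.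
  have [->|uv0] := eqVneq (ip u v) 0; first by rewrite expr0n/= mulr_ge0.
  have := H (- (ip v v + 1) / (2 * ip u v)); rewrite u0.
  suff -> : 2 * (- (ip v v + 1) / (2 * ip u v)) * ip u v = - (ip v v + 1) by lra.
  by field.
have := H (- ip u v / ip u u).
have -> : (- ip u v / ip u u) ^+ 2 * ip u u + 2 * (- ip u v / ip u u) * ip u v
    + ip v v = (ip u u * ip v v - ip u v ^+ 2) / ip u u by field.
by rewrite pmulr_lge0 ?subr_ge0// invr_gt0 lt0r u0 ip_ge0.
Qed.

Lemma semi_ip_normZ a u : Num.sqrt (ip (a *: u) (a *: u)) = `|a| * Num.sqrt (ip u u).
Proof.
have ip0 w : ip 0 w = 0.
  by have := ip_linear 1 0 0 w; rewrite scaler0 addr0 mul1r; lra.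
rewrite -[a *: u]addr0 semi_ip_sqr (ipC u) !ip0 mulr0 !addr0.
by rewrite sqrtrM ?sqr_ge0// sqrtr_sqr.
Qed.

Lemma semi_ip_triangle u v :
  Num.sqrt (ip (u + v) (u + v)) <= Num.sqrt (ip u u) + Num.sqrt (ip v v).
Proof.
rewrite -[leRHS]ger0_norm ?addr_ge0 ?sqrtr_ge0// -sqrtr_sqr ler_wsqrtr//.
have := semi_ip_sqr 1 u v; rewrite scale1r => ->.
rewrite sqrrD !sqr_sqrtr// expr1n mul1r mulr1 lerD2r lerD2l mulr_natl mulr2n.
rewrite -mulr2n ler_wMn2r//.
exact: le_trans (ler_norm _) (semi_ip_cauchy_schwarz u v).
Qed.

End semi_inner_product.

(** * The inner product of L^2 *)

Section L2_inner_product.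
Context d (T : measurableType d) (R : realType) (mu : {measure set T -> \bar R}).
Implicit Types u v w : L2 mu.

Lemma measurable_L2 u : measurable_fun setT (u : T -> R).
Proof. exact: measurable_funP (L2_repr u). Qed.

Lemma integrable_L2M u v : mu.-integrable setT (fun x => (u x * v x)%:E).
Proof. exact/Lfun1_integrable/Lfun2_mul_Lfun1/LfunP/LfunP. Qed.

Lemma integrable_L2_sqr u : mu.-integrable setT (fun x => (u x ^+ 2)%:E).
Proof. exact: integrable_L2M. Qed.

(** Evaluation goes through a chosen representative of the class, so linearity can only hold almost
    everywhere. *)
Lemma L2_fun_linear (a : R) u v :
  {ae mu, forall x, L2_fun (a *: u + v) x = a * u x + v x}.
Proof.
have -> : a *: u + v = L2_class (a *: L2_repr u + L2_repr v).
  by rewrite L2_classD -L2_scale_class !L2_reprK.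
by apply: filterS (L2_fun_class (a *: L2_repr u + L2_repr v)) => x ->.
Qed.

Lemma ae_eq_Rintegral (f g : T -> R) : measurable_fun setT f ->
  measurable_fun setT g -> {ae mu, forall x, f x = g x} ->
  \int[mu]_x f x = \int[mu]_x g x.
Proof.
move=> mf mg fg; rewrite /Rintegral; congr fine.
apply: ae_eq_integral => //; try exact/measurable_EFinP.
by apply: filterS fg => x + _ => ->.
Qed.

Lemma L2_ipC u v : L2_ip u v = L2_ip v u.
Proof. by apply: eq_Rintegral => x _; rewrite mulrC. Qed.

Lemma L2_ip_linear (a : R) u v w :
  L2_ip (a *: u + v) w = a * L2_ip u w + L2_ip v w.
Proof.
rewrite /L2_ip -RintegralZl//; last exact: integrable_L2M.
rewrite -RintegralD//; last 2 first.
- exact: (integrableZl measurableT a (integrable_L2M u w)).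
- exact: integrable_L2M.
apply: ae_eq_Rintegral.
- by apply: measurable_funM; exact: measurable_L2.
- by apply: measurable_funD; apply: measurable_funM => //;
    apply: measurable_funM; exact: measurable_L2.
- by apply: filterS (L2_fun_linear a u v) => x ->; rewrite mulrDl mulrA.
Qed.

Lemma L2_ip_ge0 u : 0 <= L2_ip u u.
Proof. by apply: Rintegral_ge0 => x _; rewrite -expr2 sqr_ge0. Qed.

Lemma L2_ip_eq0 u : L2_ip u u = 0 -> u = 0.
Proof.
move=> u0; have class0 : L2_class (0 : LfunType mu (lee1n 2)) = 0.
  by apply: (@addrI _ (L2_class 0)); rewrite -L2_classD !addr0.
rewrite -[u]L2_reprK -class0.
have : (\int[mu]_x `|(u x ^+ 2)%:E| = 0)%E.
  under eq_integral do rewrite gee0_abs ?lee_fin ?sqr_ge0//.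
  rewrite -[LHS]fineK; last exact/integrable_fin_num/integrable_L2_sqr.
  by congr EFin; rewrite -u0.
move/ae_eq_integral_abs => /(_ measurableT) h; apply/L2_classP.
have /h : measurable_fun setT (fun x => (u x ^+ 2)%:E).
  exact/measurable_EFinP/measurable_funX/measurable_L2.
by apply: filterS => x /(_ I)[/eqP]; rewrite sqrf_eq0 => /eqP.
Qed.

End L2_inner_product.

(** * Lines and slices of row-vector space *)

Section line_bound.
Context (R : realType).

(** The fundamental theorem of calculus on [[a, b]], followed by enlarging the domain of a
    nonnegative integrand to the whole line. *)
Lemma le_abs_integral_derivative (g dg : R -> R) a b : a <= b ->
  (forall x : R, is_derive x 1 g (dg x)) -> continuous dg -> g a = 0 ->
  (`|g b|%:E <= \int[lebesgue_measure]_x `|dg x|%:E)%E.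
Proof.
rewrite le_eqVlt => /predU1P[-> _ _ ->|ab gdg cdg ga].
  by rewrite normr0 integral_ge0.
have cg : continuous g by move=> x; apply/differentiable_continuous/derivable1_diffP.
have mdg : measurable_fun setT dg by exact: continuous_measurable_fun.
have -> : `|g b|%:E = `| \int[lebesgue_measure]_(x in `[a, b]) (dg x)%:E |%E.
  rewrite (@continuous_FTC2 _ _ g)//.
  - by rewrite ga sube0.
  - exact: continuous_subspaceT.
  - split; [by move=> x _|exact/cvg_at_right_filter/cg|exact/cvg_at_left_filter/cg].
  - by move=> x _; rewrite derive1E derive_val.
apply: le_trans (le_abse_integral _ _ _) _ => //.
  exact/measurable_EFinP/measurable_funTS.
by apply: ge0_subset_integral => //; exact/measurable_EFinP/measurableT_comp.
Qed.

End line_bound.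

Section slices.
Context (R : realType).
Implicit Types n : nat.

Lemma rV_cons0 n (t : R) (y : 'rV[R]_n) : rV_cons (t, y) ord0 ord0 = t.
Proof.
rewrite /rV_cons (_ : ord0 = lshift n (ord0 : 'I_1)); last exact/val_inj.
by rewrite (@row_mxEl _ _ 1 n) mxE.
Qed.

Lemma rV_consS n (t : R) (y : 'rV[R]_n) i : rV_cons (t, y) ord0 (lift ord0 i) = y ord0 i.
Proof.
rewrite /rV_cons (_ : lift ord0 i = rshift 1 i); last exact/val_inj.
by rewrite (@row_mxEr _ _ 1 n).
Qed.

Lemma rV_consDl n (h t : R) (y : 'rV[R]_n) :
  rV_cons (h + t, y) = h *: delta_mx ord0 ord0 + rV_cons (t, y).
Proof.
apply/rowP => j; rewrite [RHS]mxE [X in _ = X + _]mxE [X in _ * X]mxE.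
case: (unliftP ord0 j) => [k|] ->.
  by rewrite !rV_consS mulr0 add0r.
by rewrite !rV_cons0 mulr1.
Qed.

Lemma rV_consDr n (h t : R) (y : 'rV[R]_n) i :
  rV_cons (t, h *: delta_mx ord0 i + y) =
  h *: delta_mx ord0 (lift ord0 i) + rV_cons (t, y).
Proof.
apply/rowP => j; rewrite [RHS]mxE [X in _ = X + _]mxE [X in _ * X]mxE.
case: (unliftP ord0 j) => [k|] ->.
  by rewrite !rV_consS [LHS]mxE [X in X + _ = _]mxE [X in _ * X + _ = _]mxE
    (inj_eq lift_inj).
by rewrite !rV_cons0 mulr0 add0r.
Qed.

Lemma continuous_rV_consl n (y : 'rV[R]_n) : continuous (fun t : R => rV_cons (t, y)).
Proof.
move=> t; have -> : (fun t => rV_cons (t, y)) =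
    (fun t : R => t *: (delta_mx ord0 ord0 : 'rV_n.+1) + rV_cons (0, y)).
  by apply/funext => s; rewrite -rV_consDl addr0.
by apply: cvgD; [exact: scalel_continuous|exact: cvg_cst].
Qed.

(** Adding a fixed head coordinate does not increase distances in the sup norm. *)
Lemma continuous_rV_consr n (t : R) : continuous (fun y : 'rV[R]_n => rV_cons (t, y)).
Proof.
move=> y; apply/(@cvgrPdist_lt _ _ _ (nbhs y)) => e e0.
apply/nbhs_ballP; exists e => // z; rewrite -ball_normE /=; apply: le_lt_trans.
rewrite [leLHS]mx_normrE; apply: bigmax_le => // -[i j] _.
rewrite (ord1 i) [X in `|X|]mxE [X in _ + X]mxE /=; case: (unliftP ord0 j) => [k|] ->.
  rewrite !rV_consS [leRHS]mx_normrE.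
  have := le_bigmax (0 : R) (fun ij => `|(y - z) ij.1 ij.2|) (ord0, k).
  by rewrite /= [X in `|X| <= _]mxE [X in `|_ + X| <= _]mxE.
by rewrite !rV_cons0 subrr normr0.
Qed.

End slices.

(** * Tonelli's theorem for the iterated Lebesgue measure *)

Section tonelli.
Context (R : realType).
Implicit Types n : nat.

Lemma continuous_measurable_rV n (f : 'rV[R]_n -> R) :
  continuous f -> measurable_fun setT f.
Proof.
move=> /continuousP cf; apply: (measurability _ (RGenOInfty.measurableE R)).
move=> _ [_ [x ->] <-]; rewrite setTI; apply: open_measurable_rV; apply: cf.
exact: interval_open.
Qed.

Context (n : nat) (F : 'rV[R]_n.+1 -> \bar R).
Hypothesis mF : measurable_fun setT F.
Hypothesis F0 : forall x, (0 <= F x)%E.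

Lemma measurable_rV_slices : measurable_fun setT (F \o @rV_cons R n).
Proof. by apply: measurableT_comp => //; exact: measurable_rV_cons. Qed.

Local Open Scope ereal_scope.

Lemma measurable_rV_slice t : measurable_fun setT (fun y => F (rV_cons (t, y))).
Proof. exact: (measurableT_comp measurable_rV_slices). Qed.

Lemma measurable_rV_line y :
  measurable_fun setT (fun t : measurableTypeR R => F (rV_cons (t, y))).
Proof. exact: (measurableT_comp measurable_rV_slices). Qed.

Lemma measurable_rV_int_slice :
  measurable_fun setT (fun t : measurableTypeR R =>
    \int[lebesgue_rV R n]_y F (rV_cons (t, y))).
Proof.
exact: (measurable_fun_fubini_tonelli_F _ measurable_rV_slices (fun z => F0 _)).
Qed.

Lemma measurable_rV_int_line :
  measurable_fun setT (fun y => \int[lebesgue_measure]_t F (rV_cons (t, y))).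
Proof.
exact: (measurable_fun_fubini_tonelli_G _ measurable_rV_slices (fun z => F0 _)).
Qed.

(** The measure in dimension [n.+1] is by construction the image of a product measure under
    [rV_cons], so this is a change of variables. *)
Lemma integral_rV_prod : \int[lebesgue_rV R n.+1]_x F x =
  \int[lebesgue_measure \x lebesgue_rV R n]_z F (rV_cons z).
Proof.
exact: (ge0_integral_pushforward (@measurable_rV_cons R n)
  _ measurableT mF (fun y _ => F0 y)).
Qed.

Lemma integral_rV_slice : \int[lebesgue_rV R n.+1]_x F x =
  \int[lebesgue_measure]_t \int[lebesgue_rV R n]_y F (rV_cons (t, y)).
Proof.
by rewrite integral_rV_prod (fubini_tonelli1 _ measurable_rV_slices (fun z => F0 _)).
Qed.

Lemma integral_rV_line : \int[lebesgue_rV R n.+1]_x F x =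
  \int[lebesgue_rV R n]_y \int[lebesgue_measure]_t F (rV_cons (t, y)).
Proof.
by rewrite integral_rV_prod (fubini_tonelli2 _ measurable_rV_slices (fun z => F0 _)).
Qed.

End tonelli.

Lemma integral_rV0 (R : realType) (F : 'rV[R]_0 -> \bar R) :
  measurable_fun setT F -> (\int[lebesgue_rV R 0]_y F y = F 0%R)%E.
Proof. by move=> mF; rewrite integral_dirac// diracT mul1e. Qed.

(** The two difference quotients are the same function of [h]. This transfers derivatives between
    the whole space, its slices and its lines; the two equalities are paired so that either can be
    used for rewriting. *)
Lemma eq_along_line (R : realType) (V W : normedModType R) (f : V -> R) (g : W -> R)
    x y v w : (forall h : R, f (h *: v + x) = g (h *: w + y)) ->
  ('D_v f x = 'D_w g y) * (derivable f x v = derivable g y w).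
Proof.
move=> fg; have f0 : f x = g y by have := fg 0; rewrite !scale0r !add0r.
have quotE : (fun h : R => h^-1 *: ((f \o shift x) (h *: v) - f x)) =
    (fun h : R => h^-1 *: ((g \o shift y) (h *: w) - g y)).
  by apply/funext => h /=; rewrite fg f0.
by rewrite /derive /derivable quotE.
Qed.

Arguments eq_along_line {R V W f g x y v w}.

(** * Functions of class C^1 that vanish outside a cube *)

Section C1_supported_in_box.
Context (R : realType).
Implicit Types (n : nat) (L : R).

(** The support condition is put coordinate by coordinate, so that it passes to slices with the same
    [L]. *)
Definition C1_box n L (phi : 'rV[R]_n -> R) : Prop :=
  [/\ continuous phi,
      forall i, (forall x, derivable phi x (delta_mx ord0 i)) /\
                continuous (partial i phi) &
      forall x i, phi x != 0 -> `|x ord0 i| <= L].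

Let slice_line n (phi : 'rV[R]_n.+1 -> R) t i y (h : R) :
  (fun y => phi (rV_cons (t, y))) (h *: delta_mx ord0 i + y) =
  phi (h *: delta_mx ord0 (lift ord0 i) + rV_cons (t, y)).
Proof. by rewrite /= rV_consDr. Qed.

Lemma partial_slice n (phi : 'rV[R]_n.+1 -> R) t i y :
  partial i (fun y => phi (rV_cons (t, y))) y =
  partial (lift ord0 i) phi (rV_cons (t, y)).
Proof. exact: (eq_along_line (slice_line phi t i y)).1. Qed.

Lemma C1_box_slice n L (phi : 'rV[R]_n.+1 -> R) t :
  C1_box L phi -> C1_box L (fun y => phi (rV_cons (t, y))).
Proof.
move=> [cphi dphi bphi]; split.
- by move=> y; apply: continuous_comp; [exact: continuous_rV_consr|exact: cphi].
- move=> i; have [di ci] := dphi (lift ord0 i); split=> [x|].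
    by rewrite (eq_along_line (slice_line phi t i x)).2.
  rewrite (_ : partial i _ =
      fun y => partial (lift ord0 i) phi (rV_cons (t, y))); last first.
    by apply/funext => y; exact: partial_slice.
  by move=> y; apply: continuous_comp; [exact: continuous_rV_consr|exact: ci].
- by move=> y i /(bphi _ (lift ord0 i)); rewrite rV_consS.
Qed.

Lemma derive_line n (phi : 'rV[R]_n.+1 -> R) y (t : R) :
  derivable phi (rV_cons (t, y)) (delta_mx ord0 ord0) ->
  is_derive t 1 (fun s : R => phi (rV_cons (s, y))) (partial ord0 phi (rV_cons (t, y))).
Proof.
have line (h : R) : phi (rV_cons (h *: (1 : R) + t, y)) =
    phi (h *: delta_mx ord0 ord0 + rV_cons (t, y)) by rewrite scaler1 rV_consDl.
by move=> d; split; [rewrite (eq_along_line line).2|rewrite (eq_along_line line).1].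
Qed.

(** The bound along a line is applied to [phi ^+ 2], whose derivative in the first direction is the
    integrand on the right. *)
Lemma sqr_le_integral_line n L (phi : 'rV[R]_n.+1 -> R) t y : C1_box L phi ->
  ((phi (rV_cons (t, y)) ^+ 2)%:E <= \int[lebesgue_measure]_s
    `|2 * phi (rV_cons (s, y)) * partial ord0 phi (rV_cons (s, y))|%:E)%E.
Proof.
move=> [cphi dphi bphi]; have [d0 c0] := dphi ord0.
pose g (s : R) : R := phi (rV_cons (s, y)).
have dg (s : R) : is_derive s 1 g (partial ord0 phi (rV_cons (s, y))).
  exact: derive_line.
have cont h : continuous h -> continuous (fun s : R => h (rV_cons (s, y)) : R).
  by move=> ch s; apply: continuous_comp; [exact: continuous_rV_consl|exact: ch].
rewrite -[X in (X%:E <= _)%E]ger0_norm ?sqr_ge0//.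
(* The starting point must lie to the left of [t] and outside the cube, where [phi] vanishes; the
   minimum with [- L - 1] achieves both. *)
apply: (@le_abs_integral_derivative _ (fun s => g s ^+ 2) _
    (Num.min t (- L - 1))).
- by rewrite ge_min lexx.
- move=> s; apply: is_derive_eq.
  by rewrite /= /GRing.scale/= -mulrDl -mulr2n mulr_natl.
- move=> s; apply: cvgM; last exact: cont.
  by apply: cvgM; [exact: cvg_cst|exact: cont].
- rewrite /g.
  have [->|/(bphi _ ord0)] := eqVneq (phi (rV_cons (Num.min t (- L - 1), y))) 0.
    by rewrite expr0n.
  rewrite rV_cons0 => /ler_normlP[+ _].
  have : Num.min t (- L - 1) <= - L - 1 by rewrite ge_min lexx orbT.
  by move: (Num.min t (- L - 1)) => m; lra.
Qed.

End C1_supported_in_box.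

(** * Poincare and Ladyzhenskaya inequalities on a box *)

Local Open Scope ereal_scope.

(** Hoelder's inequality with exponents 2 and 2, squared. Without square roots it makes sense for
    infinite integrals too, so no integrability has to be tracked. *)
Lemma integral_cauchy_schwarz d (T : measurableType d) (R : realType)
    (mu : {measure set T -> \bar R}) (f g : T -> R) :
  measurable_fun setT f -> measurable_fun setT g ->
  (\int[mu]_x `|f x * g x|%:E) * (\int[mu]_x `|f x * g x|%:E) <=
  (\int[mu]_x (f x ^+ 2)%:E) * (\int[mu]_x (g x ^+ 2)%:E).
Proof.
move=> mf mg.
have half2 : (2^-1 + 2^-1 = 1 :> R)%R by lra.
have := hoelder mu mf mg (ltr0Sn R 1) (ltr0Sn R 1) half2.
rewrite Lnorm1 => H.
have sqr_norm h : \int[mu]_x (h x ^+ 2)%:E =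
    Lnorm mu 2%:E (EFin \o h) * Lnorm mu 2%:E (EFin \o h).
  rewrite -[X in X * _]poweRe1 ?Lnorm_ge0// -[X in _ * X]poweRe1 ?Lnorm_ge0//.
  rewrite -poweRD ?add_neq0_poweRD_def// powR_Lnorm//.
  by apply: eq_integral => x _; rewrite /= powR_mulrn// real_normK ?num_real.
rewrite !sqr_norm muleACA; apply: lee_pmul => //; exact: integral_ge0.
Qed.

Section box_inequalities.
Context (R : realType).
Implicit Types (n : nat) (L : R).

(** The modulus of the i-th partial derivative of [phi ^+ 2]. *)
Definition sqr_partial n (phi : 'rV[R]_n -> R) i x : \bar R :=
  `|2 * phi x * partial i phi x|%:E.

Lemma sqr_partial_ge0 n (phi : 'rV[R]_n -> R) i x : 0 <= sqr_partial phi i x.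
Proof. by rewrite lee_fin. Qed.

Section measurability.
Context n L (phi : 'rV[R]_n -> R) (phiL : C1_box L phi).

Lemma C1_box_measurable : measurable_fun setT phi.
Proof. by case: phiL => + _ _; exact: continuous_measurable_rV. Qed.

Lemma C1_box_measurable_partial i : measurable_fun setT (partial i phi).
Proof. by case: phiL => _ /(_ i)[_ +] _; exact: continuous_measurable_rV. Qed.

Lemma measurable_sqr_partial i : measurable_fun setT (sqr_partial phi i).
Proof.
apply/measurable_EFinP/measurableT_comp => //.
apply: measurable_funM; last exact: C1_box_measurable_partial.
by apply: measurable_funM => //; exact: C1_box_measurable.
Qed.

Lemma C1_box_measurableX k : measurable_fun setT (fun x => (phi x ^+ k)%:E).
Proof. by apply/measurable_EFinP/measurable_funX; exact: C1_box_measurable. Qed.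

End measurability.

Lemma integral_cst_sym_itv L (c : \bar R) : (0 <= L)%R -> 0 <= c ->
  \int[lebesgue_measure]_(t in `[(- L)%R, L]%classic) c <= (2 * L)%:E * c.
Proof.
move=> L0 c0; rewrite integral_cst// muleC lee_wpmul2r//.
have := lebesgue_measure_itv `[(- L)%R, L] => /= ->.
rewrite lte_fin; case: ifPn => _; last by rewrite lee_fin mulr_ge0.
by rewrite -EFinD opprK mulr_natl mulr2n.
Qed.

(** The bound of [sqr_le_integral_line] does not depend on the position [t]; integrating it over [t]
    in [[-L, L]] costs the factor [2 * L]. The factor [phi] left on the right is absorbed later by
    Young's inequality. *)
Lemma poincare_box n L (phi : 'rV[R]_n.+1 -> R) : (0 <= L)%R -> C1_box L phi ->
  \int[lebesgue_rV R n.+1]_x (phi x ^+ 2)%:E <=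
  (2 * L)%:E * \int[lebesgue_rV R n.+1]_x sqr_partial phi ord0 x.
Proof.
move=> L0 phiL.
have mp := measurable_sqr_partial phiL ord0.
have p0 := sqr_partial_ge0 phi ord0.
have m2 := C1_box_measurableX phiL 2.
have phi20 x : 0 <= (phi x ^+ 2)%:E by rewrite lee_fin sqr_ge0.
rewrite !integral_rV_line// -ge0_integralZl//; last 3 first.
- exact: (measurable_rV_int_line mp).
- by move=> y _; exact: integral_ge0.
- by rewrite lee_fin mulr_ge0.
apply: ge0_le_integral => //.
- by move=> y _; exact: integral_ge0.
- exact: (measurable_rV_int_line m2).
- by apply: measurable_funeM; exact: (measurable_rV_int_line mp).
move=> y _.
have -> : \int[lebesgue_measure]_t (phi (rV_cons (t, y)) ^+ 2)%:E =
    \int[lebesgue_measure]_(t in `[(- L)%R, L]%classic) (phi (rV_cons (t, y)) ^+ 2)%:E.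
  rewrite [RHS]integral_mkcond; apply: eq_integral => t _; rewrite patchE.
  case: ifPn => // /negP tL; have [->|] := eqVneq (phi (rV_cons (t, y))) 0%R.
    by rewrite expr0n.
  case: phiL => _ _ /[apply] /(_ ord0); rewrite rV_cons0 ler_norml => tL'.
  by exfalso; apply: tL; rewrite inE /= in_itv.
apply: (@le_trans _ _ (\int[lebesgue_measure]_(t in `[(- L)%R, L]%classic)
    \int[lebesgue_measure]_s sqr_partial phi ord0 (rV_cons (s, y)))).
  apply: ge0_le_integral => //.
  - by apply: measurable_funTS; exact: (measurable_rV_line m2).
  - by move=> t _; exact: sqr_le_integral_line phiL.
exact/integral_cst_sym_itv/integral_ge0.
Qed.

Lemma sqr_le_integral_rV1 L (psi : 'rV[R]_1 -> R) y : C1_box L psi ->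
  (psi y ^+ 2)%:E <= \int[lebesgue_rV R 1]_z sqr_partial psi ord0 z.
Proof.
move=> psiL; have -> : y = rV_cons (y ord0 ord0, 0%R : 'rV_0).
  by apply/rowP => i; rewrite (ord1 i) rV_cons0.
have mp := measurable_sqr_partial psiL ord0.
rewrite integral_rV_slice//; last exact: sqr_partial_ge0.
under [leRHS]eq_integral do rewrite (integral_rV0 (measurable_rV_slice mp _)).
exact: sqr_le_integral_line psiL.
Qed.

(** Write [phi ^+ 4] as [phi ^+ 2 * phi ^+ 2]. One factor is bounded by an integral along the first
    axis, a function of [y] alone, the other by an integral along the second axis, a function of [t]
    alone; the double integral of the product then separates. *)
Lemma ladyzhenskaya_rV2 L (phi : 'rV[R]_2 -> R) : C1_box L phi ->
  \int[lebesgue_rV R 2]_x (phi x ^+ 4)%:E <=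
  (\int[lebesgue_rV R 2]_x sqr_partial phi ord0 x) *
  (\int[lebesgue_rV R 2]_x sqr_partial phi (lift ord0 ord0) x).
Proof.
move=> phiL.
have m0 := measurable_sqr_partial phiL ord0.
have m1 := measurable_sqr_partial phiL (lift ord0 ord0).
have m4 := C1_box_measurableX phiL 4.
have p0 i := sqr_partial_ge0 phi i.
have phi40 x : 0 <= (phi x ^+ 4)%:E.
  by rewrite lee_fin (exprM _ 2 2) sqr_ge0.
rewrite integral_rV_slice// integral_rV_line// [X in _ * X]integral_rV_slice//.
rewrite -ge0_integralZl//; last 3 first.
- exact: (measurable_rV_int_slice m1).
- by move=> t _; exact: integral_ge0.
- by apply: integral_ge0 => y _; exact: integral_ge0.
apply: ge0_le_integral => //.
- by move=> t _; exact: integral_ge0.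
- exact: (measurable_rV_int_slice m4).
- by apply: measurable_funeM; exact: (measurable_rV_int_slice m1).
move=> t _; rewrite -ge0_integralZr//; last 3 first.
- exact: (measurable_rV_int_line m0).
- by move=> y _; exact: integral_ge0.
- exact: integral_ge0.
apply: ge0_le_integral => //.
- exact: (measurable_rV_slice m4).
- by apply: emeasurable_funM => //; exact: (measurable_rV_int_line m0).
move=> y _; rewrite (exprM _ 2 2) expr2 EFinM; apply: lee_pmul.
- by rewrite lee_fin sqr_ge0.
- by rewrite lee_fin sqr_ge0.
- exact: sqr_le_integral_line phiL.
have <- : \int[lebesgue_rV R 1]_z sqr_partial (fun y => phi (rV_cons (t, y))) ord0 z =
    \int[lebesgue_rV R 1]_z sqr_partial phi (lift ord0 ord0) (rV_cons (t, z)).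
  by apply: eq_integral => z _; rewrite /sqr_partial partial_slice.
exact: sqr_le_integral_rV1 (C1_box_slice t phiL).
Qed.

(** On the plane at height [t] the planar inequality gives the bound [A 0 * A 1]. By Cauchy-Schwarz,
    [A i] squared is at most 4 times the mass of [phi ^+ 2] on the plane times [N t i], and that
    mass is at most [M] for every [t]. Integrating over [t] turns the [N t i] into integrals over
    space. *)
Lemma ladyzhenskaya_rV3 L (phi : 'rV[R]_3 -> R) : C1_box L phi ->
  \int[lebesgue_rV R 3]_x (phi x ^+ 4)%:E <=
  4%:E * (\int[lebesgue_rV R 3]_x sqr_partial phi ord0 x) *
  \sum_(i < 2) \int[lebesgue_rV R 3]_x (partial (lift ord0 i) phi x ^+ 2)%:E.
Proof.
move=> phiL.
have m0 := measurable_sqr_partial phiL ord0.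
have m4 := C1_box_measurableX phiL 4.
have m2 := C1_box_measurableX phiL 2.
have mp i : measurable_fun setT (fun x => (partial i phi x ^+ 2)%:E).
  by apply/measurable_EFinP/measurable_funX; exact: (C1_box_measurable_partial phiL).
have p0 i := sqr_partial_ge0 phi i.
have phi40 x : 0 <= (phi x ^+ 4)%:E by rewrite lee_fin (exprM _ 2 2) sqr_ge0.
have sqr0 (a : R) : 0 <= (a ^+ 2)%:E by rewrite lee_fin sqr_ge0.
set M := \int[_]_x sqr_partial phi ord0 x; have M0 : 0 <= M by exact: integral_ge0.
have slice_mass t : \int[lebesgue_rV R 2]_y (phi (rV_cons (t, y)) ^+ 2)%:E <= M.
  rewrite /M (integral_rV_line m0 (p0 _)); apply: ge0_le_integral => //.
  - exact: (measurable_rV_slice m2).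
  - exact: (measurable_rV_int_line m0).
  - by move=> y _; exact: sqr_le_integral_line phiL.
pose N t (i : 'I_2) : \bar R :=
  \int[lebesgue_rV R 2]_y (partial (lift ord0 i) phi (rV_cons (t, y)) ^+ 2)%:E.
have N0 t i : 0 <= N t i by exact: integral_ge0.
have mN i : measurable_fun setT (fun t : measurableTypeR R => N t i).
  exact: (measurable_rV_int_slice (mp _)).
have mNs : measurable_fun setT (fun t : measurableTypeR R => \sum_(i < 2) N t i).
  exact: emeasurable_sum.
have -> : \sum_(i < 2) \int[lebesgue_rV R 3]_x (partial (lift ord0 i) phi x ^+ 2)%:E =
    \int[lebesgue_measure]_t \sum_(i < 2) N t i.
  by rewrite ge0_integral_sum//; apply: eq_bigr => i _; rewrite integral_rV_slice.
rewrite -ge0_integralZl//; last 2 first.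
- by move=> t _; exact: sume_ge0.
- by rewrite mule_ge0.
rewrite integral_rV_slice//; apply: ge0_le_integral => //.
- by move=> t _; exact: integral_ge0.
- exact: (measurable_rV_int_slice m4).
- by apply: measurable_funeM; exact: mNs.
move=> t _.
have psiL := C1_box_slice t phiL.
set psi := fun y => phi (rV_cons (t, y)) in psiL.
pose A i := \int[lebesgue_rV R 2]_y sqr_partial psi i y.
have A0 i : 0 <= A i by apply: integral_ge0 => y _; exact: sqr_partial_ge0.
have AN i : A i * A i <= 4%:E * M * N t i.
  have m2psi : measurable_fun setT (fun y => 2 * psi y)%R.
    by apply: measurable_funM => //; exact: (C1_box_measurable psiL).
  rewrite /A /sqr_partial.
  apply: le_trans (integral_cauchy_schwarz (lebesgue_rV R 2) m2psi
    (C1_box_measurable_partial psiL i)) _.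
  apply: lee_pmul; [exact: integral_ge0|exact: integral_ge0| |].
    under eq_integral do rewrite exprMn EFinM.
    rewrite ge0_integralZl//; last exact: (measurable_rV_slice m2).
    rewrite (_ : 2 ^+ 2 = 4 :> R)%R; last by ring.
    by apply: lee_wpmul2l; [rewrite lee_fin|exact: slice_mass].
  by under eq_integral do rewrite partial_slice.
apply: le_trans (ladyzhenskaya_rV2 psiL) _.
clear mNs mN; suff : A ord0 * A (lift ord0 ord0) <= 4%:E * M * \sum_(i < 2) N t i by [].
move: (A) (N t) A0 (N0 t) AN => {}A Nt {}A0 {}N0 AN.
rewrite big_ord_recl big_ord1 ge0_muleDr//.
(* The product of the two is at most the larger square, which avoids square roots of extended
   reals. *)
have [le01|/ltW le10] := leP (A ord0) (A (lift ord0 ord0)).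
  apply: (@le_trans _ _ (A (lift ord0 ord0) * A (lift ord0 ord0))).
    by apply: lee_pmul.
  by rewrite (le_trans (AN _))// leeDr// !mule_ge0.
apply: (@le_trans _ _ (A ord0 * A ord0)); first by apply: lee_pmul.
by rewrite (le_trans (AN _))// leeDl// !mule_ge0.
Qed.

End box_inequalities.

Local Close Scope ereal_scope.

(** * Test functions *)

Lemma integral_mrestr_support d (T : measurableType d) (R : realType)
    (mu : {measure set T -> \bar R}) (D : set T) (mD : measurable D) (F : T -> \bar R) :
  (forall x, ~ D x -> F x = 0%E) ->
  (\int[mrestr mu mD]_x F x = \int[mu]_x F x)%E.
Proof.
move=> F0; have patchF : F \_ D = F.
  by apply/funext => x; rewrite patchE; case: ifPn => // /negP; rewrite inE => /F0.
rewrite -patchF -!integral_mkcond; apply: eq_measure_integral => A _ AD.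
by rewrite -[LHS]/(mu (A `&` D)) setIidl.
Qed.

Section test_functions.
Context (R : realType) (d : nat) (Omega : set 'rV[R]_d) (oOmega : open Omega).
Hypothesis bOmega : bounded_set Omega.
Local Notation mu := (dx oOmega).

Let box L := [set x : 'rV[R]_d | forall i, `[- L, L]%classic (x ord0 i)].

Lemma bounded_in_box : exists2 L : R, 0 < L & Omega `<=` box L.
Proof.
have [M [Mreal OM]] := bOmega; exists (`|M| + 1); first by rewrite ltr_wpDl.
move=> x Ox i /=; rewrite in_itv/= -ler_norml.
have /(_ x Ox) := OM (`|M| + 1) (ltr_pwDr ltr01 (ler_norm _)).
apply: le_trans; rewrite [leRHS]mx_normrE.
exact: (le_bigmax (0 : R) (fun ij => `|x ij.1 ij.2|) (ord0, i)).
Qed.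

Let measurable_box L : measurable (box L).
Proof.
rewrite (_ : box L = \bigcap_(i in [set` index_enum 'I_d])
    [set x : 'rV[R]_d | `[- L, L]%classic (x ord0 i)]).
  rewrite bigcap_seq; apply: bigsetI_measurable => i _.
  rewrite -[X in measurable X]setTI; apply: (@measurable_rV_coord R d i) => //.
apply/seteqP; split=> [y yA i _|y yA i]; first exact: yA.
by apply: (yA i); rewrite /= mem_index_enum.
Qed.

Lemma dx_finite : (mu setT < +oo)%E.
Proof.
have [L L0 OL] := bounded_in_box.
apply: (@le_lt_trans _ _ (lebesgue_rV R d (box L))).
  rewrite -[leLHS]/(lebesgue_rV R d (setT `&` Omega)) setTI.
  apply: le_measure => //; rewrite inE; last exact: measurable_box.
  exact: open_measurable_rV.
rewrite (lebesgue_rV_box (A := fun=> `[- L, L]%classic)); last first.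
  by move=> _; exact: measurable_itv.
under eq_bigr do rewrite lebesgue_measure_itv/= lte_fin gtrN// -EFinD.
by rewrite prodEFin ltry.
Qed.

Lemma continuous_bounded (f : 'rV[R]_d -> R) : continuous f ->
  exists M : R, forall x, Omega x -> `|f x| <= M.
Proof.
move=> cf; have [L L0 OL] := bounded_in_box.
have cbox : compact (box L).
  by apply: (@rV_compact _ _ (fun=> `[- L, L]%classic)) => _; exact: segment_compact.
have /compact_bounded[M [Mreal fM]] : compact (f @` box L).
  by apply: continuous_compact cbox; exact: continuous_subspaceT.
exists (M + 1) => x Ox; apply: (fM (M + 1)); first by rewrite ltrDl.
by exists x => //; exact: OL.
Qed.

Section supported.
Context (f : 'rV[R]_d -> R) (cf : continuous f) (f0 : forall x, ~ Omega x -> f x = 0).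

Lemma integral_dx_support (F : R -> \bar R) : F 0 = 0%E ->
  (\int[mu]_x F (f x) = \int[lebesgue_rV R d]_x F (f x))%E.
Proof. by move=> F0; apply: integral_mrestr_support => x /f0 ->. Qed.

(** A bounded function is integrable for a finite measure. *)
Lemma supported_integrable (h : R -> R) : continuous h ->
  mu.-integrable setT (EFin \o (h \o f)).
Proof.
move=> ch; have cgf : continuous (h \o f).
  by move=> x; apply: continuous_comp; [exact: cf|exact: ch].
have [M hM] := continuous_bounded cgf.
apply: measurable_bounded_integrable => //.
- exact: dx_finite.
- exact: continuous_measurable_rV.
(* The bound has to hold on the whole space: off [Omega] the function takes the value [h 0]. *)
exists (Num.max M `|h 0|); split=> [|m Mm x _]; first exact: num_real.
apply: le_trans (ltW Mm); rewrite le_max /=.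
have [Ox|nOx] := pselect (Omega x); first by rewrite hM.
by rewrite f0// lexx orbT.
Qed.

End supported.

(** Converts the extended-real integrals over the whole space of the cube inequalities into real
    integrals over [Omega]. *)
Lemma support_integral (f : 'rV[R]_d -> R) (h : R -> R) :
  continuous f -> (forall x, ~ Omega x -> f x = 0) -> continuous h -> h 0 = 0 ->
  (\int[lebesgue_rV R d]_x (h (f x))%:E = (\int[mu]_x h (f x))%:E)%E.
Proof.
move=> cf f0 ch h0; rewrite -(integral_dx_support f0 (F := EFin \o h))/= ?h0//.
by rewrite /Rintegral fineK//; exact/integrable_fin_num/supported_integrable.
Qed.

Section test_function_theory.
Context (phi : 'rV[R]_d -> R) (tphi : test_function Omega phi).

Lemma test_function_continuous : continuous phi.
Proof. by case: tphi => /(_ 0%N)[]. Qed.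

Lemma test_function_partial_continuous i : continuous (partial i phi).
Proof. by case: tphi => /(_ 1%N)[_ /(_ i)[_ []]]. Qed.

Lemma test_function_support x : ~ Omega x -> phi x = 0.
Proof.
move=> Ox; apply: contra_notP Ox => /eqP phix0.
by case: tphi => _ _; apply; exact: subset_closure.
Qed.

(** A point off [Omega] lies in the open complement of the closed support, so [phi] is zero in a
    neighbourhood of it. *)
Lemma test_function_partial_support i x : ~ Omega x -> partial i phi x = 0.
Proof.
move=> Ox; rewrite /partial -(derive_cst (0 : R) x (delta_mx ord0 i)).
apply: near_eq_derive.
have : nbhs x (~` closure [set x | phi x != 0]).
  apply: open_nbhs_nbhs; split; first exact/closed_openC/closed_closure.
  by case: tphi => _ _ KO /KO.
apply: filterS => y /= Ky; apply: contra_notP Ky => /eqP phiy.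
exact: subset_closure.
Qed.

Lemma test_function_box L : Omega `<=` box L -> C1_box L phi.
Proof.
move=> OL; split; first exact: test_function_continuous.
- move=> i; split; last exact: test_function_partial_continuous.
  by case: tphi => /(_ 1%N)[_ /(_ i)[]].
- move=> x i phix; have /OL/(_ i)/= : Omega x.
    by apply: contrapT => /test_function_support/eqP; apply/negP.
  by rewrite in_itv/= -ler_norml.
Qed.

End test_function_theory.

End test_functions.

(** * Poincare and Sobolev inequalities for test functions *)

Section test_function_inequalities.
Context (R : realType).

Section young.
Context (d : nat) (Omega : set 'rV[R]_d) (oOmega : open Omega).
Hypothesis bOmega : bounded_set Omega.
Local Notation mu := (dx oOmega).
Context (phi : 'rV[R]_d -> R) (tphi : test_function Omega phi).

Let cphi := test_function_continuous tphi.
Let cpartial i := @test_function_partial_continuous _ _ _ _ tphi i.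
Let phi0 := test_function_support tphi.
Let partial0 i := @test_function_partial_support _ _ _ _ tphi i.

Lemma test_function_integrableX k : mu.-integrable setT (fun x => (phi x ^+ k)%:E).
Proof.
apply: (supported_integrable oOmega bOmega cphi phi0 (h := fun r => r ^+ k)).
exact: exprn_continuous.
Qed.

Lemma test_function_partial_integrable_sqr i :
  mu.-integrable setT (fun x => (partial i phi x ^+ 2)%:E).
Proof.
apply: (supported_integrable oOmega bOmega (@cpartial i) (@partial0 i)
  (h := fun r => r ^+ 2)).
exact: exprn_continuous.
Qed.

Let prod i x := 2 * phi x * partial i phi x.

Let cprod i : continuous (prod i).
Proof.
move=> x; apply: (@continuousM _ _ (fun x => 2 * phi x)); last exact: cpartial.
by apply: (@continuousM _ _ (fun=> 2)); [exact: cst_continuous|exact: cphi].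
Qed.

Let prod0 i x : ~ Omega x -> prod i x = 0.
Proof. by move=> /phi0 p0; rewrite /prod p0 mulr0 mul0r. Qed.

Let cnorm : continuous (fun r : R => `|r|).
Proof. exact: norm_continuous. Qed.

Lemma integral_sqr_partial i : (\int[lebesgue_rV R d]_x sqr_partial phi i x =
  (\int[mu]_x `|2 * phi x * partial i phi x|)%:E)%E.
Proof.
exact: (support_integral oOmega bOmega (@cprod i) (@prod0 i) cnorm (normr0 _)).
Qed.

Lemma integral_partial_sqr i :
  (\int[lebesgue_rV R d]_x (partial i phi x ^+ 2)%:E =
  (\int[mu]_x (partial i phi x ^+ 2))%:E)%E.
Proof.
apply: (support_integral oOmega bOmega (@cpartial i) (@partial0 i)
  (h := fun r => r ^+ 2)).
  exact: exprn_continuous.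
by rewrite expr0n.
Qed.

Lemma integral_test_functionX k : (\int[lebesgue_rV R d]_x (phi x ^+ k.+1)%:E =
  (\int[mu]_x (phi x ^+ k.+1))%:E)%E.
Proof.
apply: (support_integral oOmega bOmega cphi phi0 (h := fun r => r ^+ k.+1)).
  exact: exprn_continuous.
by rewrite expr0n.
Qed.

(** Pointwise, the right-hand side exceeds the left by [(a * p - q) ^+ 2 / a], where [p] and [q] are
    the moduli of [phi] and of its derivative. The weight [a] is left free so that the first term
    can be made small. *)
Lemma young_sqr_partial a i : 0 < a ->
  \int[mu]_x `|2 * phi x * partial i phi x| <=
  a * \int[mu]_x (phi x ^+ 2) + a^-1 * \int[mu]_x (partial i phi x ^+ 2).
Proof.
move=> a0; have i1 := test_function_integrableX 2.
have i2 := test_function_partial_integrable_sqr i.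
have i1' := integrableZl measurableT a i1.
have i2' := integrableZl measurableT a^-1 i2.
rewrite -!RintegralZl// -RintegralD//.
apply: le_Rintegral => //.
- exact: (supported_integrable oOmega bOmega (@cprod i) (@prod0 i) cnorm).
- exact: (integrableD measurableT i1' i2').
move=> x _; rewrite !normrM (ger0_norm (_ : 0 <= 2))//.
rewrite -(real_normK (num_real (phi x))) -(real_normK (num_real (partial i phi x))).
move: `|phi x| `|partial i phi x| => p q.
have -> : a * p ^+ 2 + a^-1 * q ^+ 2 = 2 * p * q + (a * p - q) ^+ 2 / a.
  by field; rewrite gt_eqF.
by rewrite lerDl mulr_ge0 ?sqr_ge0// invr_ge0 ltW.
Qed.

End young.

Lemma test_function_poincare n (Omega : set 'rV[R]_n.+1) (oOmega : open Omega) :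
  bounded_set Omega -> exists2 C : R, 0 <= C & forall phi, test_function Omega phi ->
    \int[dx oOmega]_x (phi x ^+ 2) <=
    C * \int[dx oOmega]_x (partial ord0 phi x ^+ 2).
Proof.
move=> bO; have [L L0 OL] := bounded_in_box bO.
exists (16 * L ^+ 2); first by rewrite mulr_ge0 ?sqr_ge0.
move=> phi tphi; have := poincare_box (ltW L0) (test_function_box tphi OL).
rewrite (integral_sqr_partial oOmega bO tphi) (integral_test_functionX oOmega bO tphi).
rewrite -EFinM lee_fin => H.
(* With this weight the factor [2 * L] leaves exactly half of the integral of [phi ^+ 2] on the
   right. Absorbing it gives the constant [16 * L ^+ 2]. *)
have a0 : 0 < (4 * L)^-1 by rewrite invr_gt0 mulr_gt0.
have := young_sqr_partial oOmega bO tphi ord0 a0; rewrite invrK.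
move: H; set I := Rintegral _ _ _; set J := Rintegral _ _ _; set K := Rintegral _ _ _.
move=> IJ JK; have : I <= 2 * L * ((4 * L)^-1 * I + 4 * L * K).
  by apply: le_trans IJ _; rewrite ler_wpM2l// mulr_ge0// ltW.
have -> : 2 * L * ((4 * L)^-1 * I + 4 * L * K) = I / 2 + 8 * L ^+ 2 * K.
  by field; rewrite gt_eqF.
lra.
Qed.

Definition gradient_energy d (Omega : set 'rV[R]_d) (oOmega : open Omega)
  (phi : 'rV[R]_d -> R) : R := \sum_i \int[dx oOmega]_x (partial i phi x ^+ 2).

(** Young's inequality with weight 1 and Poincare's inequality bound each integral of
    [2 * phi * partial i phi] in modulus by [(C + 1) * S], [S] being the gradient energy.
    Ladyzhenskaya's inequality multiplies two such bounds in the plane, and [4 * (C + 1) * S] by [S]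
    in space. The maximum yields one constant for both conclusions. *)
Lemma test_function_sobolev d (hd : d = 2%N \/ d = 3%N) (Omega : set 'rV[R]_d)
    (oOmega : open Omega) :
  bounded_set Omega -> exists2 C : R, 0 <= C & forall phi, test_function Omega phi ->
    \int[dx oOmega]_x (phi x ^+ 2) <= C * gradient_energy oOmega phi /\
    \int[dx oOmega]_x (phi x ^+ 4) <= C * gradient_energy oOmega phi ^+ 2.
Proof.
have int_ge0 d' (Om : set 'rV[R]_d') (oOm : open Om) phi i :
    0 <= \int[dx oOm]_x (partial i phi x ^+ 2).
  by apply: Rintegral_ge0 => x _; exact: sqr_ge0.
have part_le d' (Om : set 'rV[R]_d') (oOm : open Om) phi i :
    \int[dx oOm]_x (partial i phi x ^+ 2) <= gradient_energy oOm phi.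
  by rewrite /gradient_energy (bigD1 i)//= lerDl sumr_ge0.
case: hd Omega oOmega => -> Omega oOmega bO;
  have [C C0 HC] := test_function_poincare oOmega bO;
  have [L L0 OL] := bounded_in_box bO.
- exists (Num.max C ((C + 1) ^+ 2)); first by rewrite le_max C0.
  move=> phi tphi; set S := gradient_energy _ _.
  have S0 : 0 <= S by exact: sumr_ge0.
  have P : \int[dx oOmega]_x (phi x ^+ 2) <= C * S.
    by apply: le_trans (HC _ tphi) _; rewrite ler_wpM2l// part_le.
  split; first by apply: le_trans P _; rewrite ler_wpM2r// le_max lexx.
  have := ladyzhenskaya_rV2 (test_function_box tphi OL).
  rewrite (integral_test_functionX oOmega bO tphi) !(integral_sqr_partial oOmega bO tphi).
  rewrite -EFinM lee_fin => /le_trans; apply.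
  apply: (@le_trans _ _ ((C + 1) ^+ 2 * S ^+ 2)); last first.
    by rewrite ler_wpM2r ?sqr_ge0// le_max lexx orbT.
  have A i : \int[dx oOmega]_x `|2 * phi x * partial i phi x| <= (C + 1) * S.
    apply: le_trans (young_sqr_partial oOmega bO tphi i ltr01) _.
    by rewrite invr1 !mul1r mulrDl mul1r lerD// part_le.
  rewrite -exprMn expr2 ler_pM//; exact: Rintegral_ge0.
- exists (Num.max C (4 * (C + 1))); first by rewrite le_max C0.
  move=> phi tphi; set S := gradient_energy _ _.
  have S0 : 0 <= S by exact: sumr_ge0.
  have P : \int[dx oOmega]_x (phi x ^+ 2) <= C * S.
    by apply: le_trans (HC _ tphi) _; rewrite ler_wpM2l// part_le.
  split; first by apply: le_trans P _; rewrite ler_wpM2r// le_max lexx.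
  have := ladyzhenskaya_rV3 (test_function_box tphi OL).
  rewrite (integral_test_functionX oOmega bO tphi) (integral_sqr_partial oOmega bO tphi).
  under [X in (_ <= _ * X)%E]eq_bigr do rewrite (integral_partial_sqr oOmega bO tphi).
  rewrite sumEFin -!EFinM lee_fin => /le_trans; apply.
  apply: (@le_trans _ _ (4 * (C + 1) * S ^+ 2)); last first.
    by rewrite ler_wpM2r ?sqr_ge0// le_max lexx orbT.
  have A i : \int[dx oOmega]_x `|2 * phi x * partial i phi x| <= (C + 1) * S.
    apply: le_trans (young_sqr_partial oOmega bO tphi i ltr01) _.
    by rewrite invr1 !mul1r mulrDl mul1r lerD// part_le.
  rewrite expr2 mulrA ler_pM//.
  + by rewrite mulr_ge0// Rintegral_ge0.
  + exact: sumr_ge0.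
  + by rewrite -mulrA ler_wpM2l.
  + by rewrite /S /gradient_energy [leRHS]big_ord_recl lerDr.
Qed.

End test_function_inequalities.

(** * Passage to the Sobolev space *)

(** If [y < x], an [e] with [c * e <= (x - y) / 2] gives a contradiction. The restriction [e <= 1]
    lets a quadratic error in [e] be bounded by a linear one. *)
Lemma le_of_le_add_linear (R : realType) (x y c : R) :
  (forall e, 0 < e -> e <= 1 -> x <= y + c * e) -> x <= y.
Proof.
move=> H; rewrite leNgt; apply/negP => yx.
have c1 : 0 < `|c| + 1 by rewrite ltr_wpDl.
pose e := Num.min 1 ((x - y) / (2 * (`|c| + 1))).
have e0 : 0 < e by rewrite lt_min ltr01 divr_gt0 ?subr_gt0// mulr_gt0.
have := H e e0; rewrite ge_min lexx => /(_ isT).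
have : c * e <= (x - y) / 2.
  apply: (@le_trans _ _ ((`|c| + 1) * e)).
    by rewrite ler_wpM2r ?(ltW e0)// (le_trans (ler_norm _))// lerDl.
  apply: (@le_trans _ _ ((`|c| + 1) * ((x - y) / (2 * (`|c| + 1))))).
    by rewrite ler_wpM2l ?(ltW c1)// ge_min lexx orbT.
  rewrite le_eqVlt; apply/orP; left; apply/eqP; field.
  by rewrite gt_eqF.
lra.
Qed.

(** Let [m] be the minimum. If [m <= |b|] the first term suffices. Otherwise [m ^+ 2 - b ^+ 2]
    factors and is at most [2 * k * |a - b|], while [m ^+ 4 <= 2 * b ^+ 4 + 2 * (m ^+ 2 - b ^+ 2) ^+
    2]. At a fixed level [k], the truncated fourth power is thus controlled by an approximant [b]
    and the squared error alone. *)
Lemma truncation_le (R : realType) (a b k : R) : 0 <= k ->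
  Num.min `|a| k ^+ 4 <= 2 * b ^+ 4 + 8 * k ^+ 2 * (a - b) ^+ 2.
Proof.
move=> k0; set m := Num.min _ _.
have m0 : 0 <= m by rewrite le_min normr_ge0.
have mk : m <= k by rewrite ge_min lexx orbT.
have ma : m <= `|a| by rewrite ge_min lexx.
have b40 : 0 <= b ^+ 4 by rewrite (exprM _ 2 2) sqr_ge0.
have K0 : 0 <= 8 * k ^+ 2 * (a - b) ^+ 2 
  by rewrite mulr_ge0 ?sqr_ge0// mulr_ge0 ?sqr_ge0.
have b2 : b ^+ 2 = `|b| ^+ 2 by rewrite real_normK ?num_real.
have [mb|bm] := leP m `|b|.
  have : m ^+ 4 <= `|b| ^+ 4 by rewrite lerXn2r ?nnegrE.
  by rewrite !(exprM _ 2 2) -b2 -!(exprM _ 2 2); lra.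
have ab : `|a| - `|b| <= `|a - b| by exact: lerB_dist.
have : (m ^+ 2 - b ^+ 2) ^+ 2 <= (2 * k * `|a - b|) ^+ 2.
  rewrite lerXn2r ?nnegrE ?mulr_ge0 ?subr_ge0//.
    by rewrite b2 lerXn2r ?nnegrE// ltW.
  have -> : m ^+ 2 - b ^+ 2 = (m + `|b|) * (m - `|b|) by rewrite b2; ring.
  have b0 := normr_ge0 b.
  by apply: ler_pM; lra.
rewrite exprMn real_normK ?num_real//.
have : 0 <= (m ^+ 2 - 2 * b ^+ 2) ^+ 2 by exact: sqr_ge0.
have -> : (m ^+ 2 - 2 * b ^+ 2) ^+ 2 = 2 * (m ^+ 2 - b ^+ 2) ^+ 2 - m ^+ 4 + 2 * b ^+ 4.
  ring.
lra.
Qed.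

Section square_integrable.
Context d (T : measurableType d) (R : realType) (mu : {measure set T -> \bar R}).
Context (f g : T -> R) (mf : measurable_fun setT f) (mg : measurable_fun setT g).
Hypothesis if2 : mu.-integrable setT (fun x => (f x ^+ 2)%:E).
Hypothesis ig2 : mu.-integrable setT (fun x => (g x ^+ 2)%:E).

Lemma integrable_sqrB : mu.-integrable setT (fun x => ((f x - g x) ^+ 2)%:E).
Proof.
apply: (@le_integrable _ _ _ mu setT measurableT _
    (fun x => 2%:E * (f x ^+ 2)%:E + 2%:E * (g x ^+ 2)%:E)%E).
- exact/measurable_EFinP/measurable_funX/measurable_funB.
- move=> x _; rewrite -!EFinM -EFinD !abse_EFin lee_fin ger0_norm ?sqr_ge0//.
  rewrite ger0_norm; last by rewrite addr_ge0// mulr_ge0// sqr_ge0.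
  have := sqr_ge0 (f x + g x); rewrite sqrrD sqrrB; lra.
- exact: (integrableD measurableT (integrableZl measurableT 2 if2)
    (integrableZl measurableT 2 ig2)).
Qed.

(** Pointwise, the difference of the two sides is [(f - 2 g) ^+ 2]. *)
Lemma Rintegral_sqr_le2 : \int[mu]_x (f x ^+ 2) <=
  2 * \int[mu]_x ((f x - g x) ^+ 2) + 2 * \int[mu]_x (g x ^+ 2).
Proof.
have i1 := integrableZl measurableT 2 integrable_sqrB.
have i2 := integrableZl measurableT 2 ig2.
rewrite -!RintegralZl//; last exact: integrable_sqrB.
rewrite -RintegralD//; apply: le_Rintegral => //.
  exact: (integrableD measurableT i1 i2).
move=> x _; have := sqr_ge0 (f x - 2 * g x); lra.
Qed.

End square_integrable.

Section H10_sobolev.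
Context (R : realType) (d : nat) (Omega : set 'rV[R]_d) (oOmega : open Omega).
Hypothesis bOmega : bounded_set Omega.
Local Notation mu := (dx oOmega).

Definition H1_energy (u : H1_pair oOmega) : R := \sum_i L2_ip (u.2 i) (u.2 i).

Lemma H1_energy_ge0 u : 0 <= H1_energy u.
Proof. by apply: sumr_ge0 => i _; exact: L2_ip_ge0. Qed.

Lemma H10_approx (u : H1_pair oOmega) e : H10 u -> 0 < e ->
  exists phi, [/\ test_function Omega phi,
    \int[mu]_x ((u.1 x - phi x) ^+ 2) <= e &
    forall i, \int[mu]_x ((u.2 i x - partial i phi x) ^+ 2) <= e].
Proof.
move=> [_ [phi [tphi phiu dphiu]]] e0.
have le_e (F : nat -> R) : F n @[n --> \oo] --> 0 -> \forall n \near \oo, F n <= e.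
  move=> /cvgrPdist_le/(_ e e0); apply: filterS => n; rewrite sub0r normrN.
  exact/le_trans/ler_norm.
near \oo => n; exists (phi n); split => //.
- by near: n; exact: le_e.
- by near: n; apply: filter_forall => i; exact: le_e.
Unshelve. all: by end_near. Qed.

Lemma gradient_energy_le (u : H1_pair oOmega) phi e : test_function Omega phi ->
  (forall i, \int[mu]_x ((u.2 i x - partial i phi x) ^+ 2) <= e) ->
  gradient_energy oOmega phi <= 2 * d%:R * e + 2 * H1_energy u.
Proof.
move=> tphi ue; rewrite /gradient_energy /H1_energy mulr_sumr.
have -> : 2 * d%:R * e = \sum_(i < d) (2 * e).
  by rewrite sumr_const card_ord -[RHS]mulr_natr; ring.
rewrite -big_split/=; apply: ler_sum => i _.
have mp : measurable_fun setT (partial i phi).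
  by apply: continuous_measurable_rV; exact: (test_function_partial_continuous tphi).
have ip := test_function_partial_integrable_sqr oOmega bOmega tphi i.
apply: le_trans (Rintegral_sqr_le2 mp (measurable_L2 (u.2 i)) ip
  (integrable_L2_sqr (u.2 i))) _.
rewrite lerD2r ler_wpM2l//; apply: le_trans (ue i).
by under eq_Rintegral do rewrite -sqrrN opprB.
Qed.

(** The quadratic bound follows from approximation within [e] and [e -> 0]. For the fourth power,
    [truncation_le] at a fixed [k] and [e -> 0] bound the truncations by a number independent of
    [k], and monotone convergence in [k] concludes. The factor 8 is 2 from [truncation_le] times 4
    from squaring [2 * E]. *)
Lemma H10_sobolev : d = 2%N \/ d = 3%N -> exists2 C : R, 0 <= C &
  forall u : H1_pair oOmega, H10 u ->
  [/\ L2_ip u.1 u.1 <= C * H1_energy u,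
      mu.-integrable setT (fun x => (u.1 x ^+ 4)%:E) &
      \int[mu]_x (u.1 x ^+ 4) <= C * H1_energy u ^+ 2].
Proof.
move=> hd; have {hd}[C C0 HC] := test_function_sobolev hd oOmega bOmega.
exists (8 * C); first by rewrite mulr_ge0.
move=> u Hu; set E := H1_energy u; have E0 : 0 <= E by exact: H1_energy_ge0.
have mu1 := measurable_L2 u.1.
have iu2 := integrable_L2_sqr u.1.
have d0 : 0 <= d%:R :> R by [].
have mphi phi : test_function Omega phi -> measurable_fun setT phi.
  by move=> tphi; apply: continuous_measurable_rV; exact: (test_function_continuous tphi).
have poincare : L2_ip u.1 u.1 <= 8 * C * E.
  apply: (@le_trans _ _ (4 * C * E)); last first.
    by rewrite ler_wpM2r// ler_wpM2r// ler_nat.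
  apply: (@le_of_le_add_linear _ _ _ (2 + 4 * C * d%:R)) => e e0 _.
  have [phi [tphi ue due]] := H10_approx Hu e0.
  have := Rintegral_sqr_le2 mu1 (mphi _ tphi) iu2
    (test_function_integrableX oOmega bOmega tphi 2).
  have [P _] := HC _ tphi.
  have := ler_wpM2l C0 (gradient_energy_le tphi due).
  rewrite -/E -[\int[mu]_x (u.1 x ^+ 2)]/(L2_ip u.1 u.1).
  clear d0; move: (d%:R : R) (L2_ip _ _) (gradient_energy _ _) P ue => D I S; lra.
pose tr (k : nat) x := Num.min `|u.1 x| k%:R ^+ 4.
have mtr k : measurable_fun setT (tr k).
  apply/measurable_funX; apply: measurable_minr => //; exact/measurableT_comp.
have tr0 k x : 0 <= tr k x by rewrite exprn_ge0// le_min normr_ge0/=.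
pose B := 8 * C * E ^+ 2.
have trB k : (\int[mu]_x (tr k x)%:E <= B%:E)%E.
  have trphi phi e : test_function Omega phi ->
      \int[mu]_x ((u.1 x - phi x) ^+ 2) <= e ->
      (\int[mu]_x (tr k x)%:E <=
       (2 * \int[mu]_x (phi x ^+ 4) + 8 * k%:R ^+ 2 * e)%:E)%E.
    move=> tphi ue.
    have i4 := integrableZl measurableT 2
      (test_function_integrableX oOmega bOmega tphi 4).
    have i2 := integrable_sqrB mu1 (mphi _ tphi) iu2
      (test_function_integrableX oOmega bOmega tphi 2).
    have i2k := integrableZl measurableT (8 * k%:R ^+ 2) i2.
    have isum := integrableD measurableT i4 i2k.
    apply: (@le_trans _ _ (\int[mu]_x (2 * phi x ^+ 4 +
        8 * k%:R ^+ 2 * (u.1 x - phi x) ^+ 2)%:E)%E).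
      apply: ge0_le_integral => //.
      - by move=> x _; rewrite lee_fin.
      - exact/measurable_EFinP.
      - exact: measurable_int isum.
      - by move=> x _; rewrite lee_fin truncation_le.
    rewrite -[leLHS]fineK; last exact: integrable_fin_num isum.
    rewrite lee_fin -/(Rintegral mu setT _).
    rewrite RintegralD// !RintegralZl//; last first.
      exact: test_function_integrableX.
    by rewrite lerD2l ler_wpM2l// mulr_ge0.
  (* One approximant, with error 1, shows finiteness; the comparison can then be made between real
     numbers. *)
  have fin_tr : (\int[mu]_x (tr k x)%:E)%E \is a fin_num.
    have [phi [tphi ue _]] := H10_approx Hu ltr01.
    rewrite ge0_fin_numE; last by apply: integral_ge0 => x _; rewrite lee_fin.
    by rewrite (le_lt_trans (trphi _ _ tphi ue))// ltry.
  rewrite -(fineK fin_tr) lee_fin /B.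
  apply: (@le_of_le_add_linear _ _ _
    (8 * k%:R ^+ 2 + 2 * C * (4 * d%:R ^+ 2 + 8 * d%:R * E))) => e e0 e1.
  have [phi [tphi ue due]] := H10_approx Hu e0.
  have := trphi _ _ tphi ue; rewrite -[leLHS](fineK fin_tr) lee_fin.
  have [_ P] := HC _ tphi.
  have S := gradient_energy_le tphi due.
  have S0 : 0 <= gradient_energy oOmega phi.
    by apply: sumr_ge0 => i _; apply: Rintegral_ge0 => x _; exact: sqr_ge0.
  have S2 : gradient_energy oOmega phi ^+ 2 <=
      4 * E ^+ 2 + (4 * d%:R ^+ 2 + 8 * d%:R * E) * e.
    apply: (@le_trans _ _ ((2 * d%:R * e + 2 * E) ^+ 2)).
      by rewrite lerXn2r ?nnegrE// (le_trans S0).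
    have -> : (2 * d%:R * e + 2 * E) ^+ 2 =
        4 * E ^+ 2 + (4 * d%:R ^+ 2 * e + 8 * d%:R * E) * e by ring.
    rewrite lerD2l ler_wpM2r ?(ltW e0)// lerD2r.
    by rewrite ler_piMr ?mulr_ge0.
  have := ler_wpM2l C0 S2; move: P.
  move: (8 * k%:R ^+ 2 : R) (d%:R : R) (fine _) (gradient_energy _ _ ^+ 2)
    (Rintegral _ _ _) => K D t s r.
  clear d0.
  lra.
have tr_mono x m n : (m <= n)%N -> tr m x <= tr n x.
  move=> mn; rewrite /tr; apply: lerXn2r; rewrite ?nnegrE le_min ?normr_ge0//=.
  by rewrite !ge_min lexx/= ler_nat mn orbT.
(* At each point the sequence is constant once [n] exceeds [|u.1 x|]. *)
have lim_tr x : (tr n x)%:E @[n --> \oo] --> (u.1 x ^+ 4)%:E.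
  apply: cvg_near_cst.
  exists (Num.truncn `|u.1 x|).+1 => // n /= nu; rewrite /tr min_l.
    by rewrite !(exprM _ 2 2) real_normK ?num_real.
  apply: ltW; apply: lt_le_trans (truncnS_gt _) _; rewrite ?ler_nat//.
have uB : (\int[mu]_x (u.1 x ^+ 4)%:E <= B%:E)%E.
  rewrite (_ : \int[mu]_x _ = \int[mu]_x limn (fun n => (tr n x)%:E))%E; last first.
    by apply: eq_integral => x _; apply/esym/cvg_lim.
  rewrite monotone_convergence//.
  - apply: lime_le; last by apply: nearW => n; exact: trB.
    apply: ereal_nondecreasing_is_cvgn => m n mn; apply: ge0_le_integral => //.
    + by move=> x _; rewrite lee_fin.
    + exact/measurable_EFinP.
    + exact/measurable_EFinP.
    + by move=> x _; rewrite lee_fin tr_mono.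
  - by move=> n; exact/measurable_EFinP.
  - by move=> n x _; rewrite lee_fin.
  - by move=> x _ m n mn; rewrite lee_fin tr_mono.
have iu4 : mu.-integrable setT (fun x => (u.1 x ^+ 4)%:E).
  apply/integrableP; split; first exact/measurable_EFinP/measurable_funX.
  under eq_integral do rewrite abse_EFin ger0_norm ?(exprM _ 2 2) ?sqr_ge0// -exprM.
  by rewrite (le_lt_trans uB)// ltry.
split => //; rewrite -lee_fin /Rintegral fineK//; exact: integrable_fin_num.
Qed.

End H10_sobolev.

(** * The trilinear form *)

Section triple_products.
Context d (T : measurableType d) (R : realType) (mu : {measure set T -> \bar R}).
Implicit Types a b c : L2 mu.

Definition fourth_integrable a : Prop := mu.-integrable setT (fun x => (a x ^+ 4)%:E).

Definition triple a b c : R := \int[mu]_x (a x * b x * c x).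

Lemma measurable_triple a b c : measurable_fun setT (fun x => a x * b x * c x).
Proof.
by apply: measurable_funM; [apply: measurable_funM|]; exact: measurable_L2.
Qed.

(** Young's inequality twice: for the product of [q] and [p * r], then for that of [p ^+ 2] and
    [r ^+ 2]. It replaces Hoelder's inequality with exponents 4, 2, 4; the product form of the bound
    is recovered later by homogeneity. *)
Lemma young_triple (p q r : R) :
  `|p * q * r| <= 2^-1 * q ^+ 2 + 4^-1 * p ^+ 4 + 4^-1 * r ^+ 4.
Proof.
rewrite ler_norml.
have := sqr_ge0 (q - p * r); have := sqr_ge0 (q + p * r).
have := sqr_ge0 (p ^+ 2 - r ^+ 2).
have -> : (p ^+ 2 - r ^+ 2) ^+ 2 = p ^+ 4 + r ^+ 4 - 2 * (p * r) ^+ 2 by ring.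
rewrite sqrrB sqrrD; move: (p ^+ 4) (r ^+ 4) => P S.
have -> : p * q * r = q * (p * r) by ring.
move: (p * r) => s; rewrite -mulr_natr.
move: (q * s) (q ^+ 2) (s ^+ 2) => x y z h1 h2 h3.
apply/andP; split; lra.
Qed.

Section integrability.
Context a b c (a4 : fourth_integrable a) (c4 : fourth_integrable c).

Let majorant x := (2^-1%:E * (b x ^+ 2)%:E + 4^-1%:E * (a x ^+ 4)%:E
  + 4^-1%:E * (c x ^+ 4)%:E)%E.

Let majorant_integrable : mu.-integrable setT majorant.
Proof.
exact: (integrableD measurableT (integrableD measurableT
  (integrableZl measurableT 2^-1 (integrable_L2_sqr b))
  (integrableZl measurableT 4^-1 a4)) (integrableZl measurableT 4^-1 c4)).
Qed.

Lemma integrable_triple : mu.-integrable setT (fun x => (a x * b x * c x)%:E).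
Proof.
apply: (le_integrable measurableT _ _ majorant_integrable).
  exact/measurable_EFinP/measurable_triple.
move=> x _; rewrite /majorant -!EFinM -!EFinD !abse_EFin lee_fin.
exact: le_trans (young_triple _ _ _) (ler_norm _).
Qed.

Lemma triple_le : `|triple a b c| <= 2^-1 * L2_ip b b
  + 4^-1 * \int[mu]_x (a x ^+ 4) + 4^-1 * \int[mu]_x (c x ^+ 4).
Proof.
have i1 := integrableZl measurableT 2^-1 (integrable_L2_sqr b).
have i2 := integrableZl measurableT 4^-1 a4.
have i3 := integrableZl measurableT 4^-1 c4.
have i12 := integrableD measurableT i1 i2.
apply: le_trans (le_normr_Rintegral measurableT integrable_triple) _.
rewrite -!RintegralZl//; last exact: integrable_L2M.
rewrite -!RintegralD//; apply: le_Rintegral => //.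
- exact: (integrable_norm integrable_triple).
- by move=> x _; exact: young_triple.
Qed.

End integrability.

Lemma triple_linear1 k a a' b c : fourth_integrable a -> fourth_integrable a' ->
  fourth_integrable c ->
  triple (k *: a + a') b c = k * triple a b c + triple a' b c.
Proof.
move=> a4 a'4 c4; rewrite /triple -RintegralZl//; last exact: integrable_triple.
rewrite -RintegralD//; last 2 first.
- exact: (integrableZl measurableT k (integrable_triple b a4 c4)).
- exact: integrable_triple.
apply: ae_eq_Rintegral.
- exact: measurable_triple.
- apply: measurable_funD; last exact: measurable_triple.
  by apply: measurable_funM => //; exact: measurable_triple.
- by apply: filterS (L2_fun_linear k a a') => x ->; ring.
Qed.

Lemma triple_linear2 k a b b' c : fourth_integrable a -> fourth_integrable c ->
  triple a (k *: b + b') c = k * triple a b c + triple a b' c.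
Proof.
move=> a4 c4; rewrite /triple -RintegralZl//; last exact: integrable_triple.
rewrite -RintegralD//; last 2 first.
- exact: (integrableZl measurableT k (integrable_triple b a4 c4)).
- exact: integrable_triple.
apply: ae_eq_Rintegral.
- exact: measurable_triple.
- apply: measurable_funD; last exact: measurable_triple.
  by apply: measurable_funM => //; exact: measurable_triple.
- by apply: filterS (L2_fun_linear k b b') => x ->; ring.
Qed.

Lemma tripleC a b c : triple a b c = triple c b a.
Proof. by apply: eq_Rintegral => x _; ring. Qed.

Lemma triple_linear3 k a b c c' : fourth_integrable a -> fourth_integrable c ->
  fourth_integrable c' ->
  triple a b (k *: c + c') = k * triple a b c + triple a b c'.
Proof.
by move=> a4 c4 c'4; rewrite ![triple a b _]tripleC triple_linear1.
Qed.

End triple_products.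

Section homogeneous.
Context (R : realType) (V : lmodType R) (E : set V) (N : V -> R).
Hypothesis E_scale : forall a u, E u -> E (a *: u).
Hypothesis N_scale : forall a u, N (a *: u) = `|a| * N u.
Hypothesis N_eq0 : forall u, E u -> N u = 0 -> u = 0.
Hypothesis N_ge0 : forall u, 0 <= N u.

(** Scale [u] to norm 1; if its norm is 0, then [u] is 0. This turns a bound on unit balls into a
    product bound, one argument at a time. *)
Lemma homogeneous_le (F : V -> R) K : (forall a u, E u -> F (a *: u) = a * F u) ->
  (forall u, E u -> N u <= 1 -> `|F u| <= K) -> forall u, E u -> `|F u| <= K * N u.
Proof.
move=> F_scale FK u Eu; have [Nu|Nu] := eqVneq (N u) 0.
  have -> : u = 0 *: u by rewrite scale0r; exact: N_eq0.
  by rewrite F_scale// mul0r normr0 scale0r -(N_eq0 Eu Nu) Nu mulr0.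
have N0 : 0 < N u by rewrite lt0r Nu N_ge0.
rewrite -ler_pdivrMr// mulrC -[(N u)^-1]gtr0_norm ?invr_gt0// -normrM -F_scale//.
by apply: FK; [exact: E_scale|rewrite N_scale gtr0_norm ?invr_gt0// mulVf].
Qed.

End homogeneous.

Lemma Rintegral_sum d (T : measurableType d) (R : realType)
    (mu : {measure set T -> \bar R}) (I : Type) (s : seq I) (F : I -> T -> R) :
  (forall i, mu.-integrable setT (EFin \o F i)) ->
  mu.-integrable setT (EFin \o (fun x => \sum_(i <- s) F i x)) /\
  \int[mu]_x \sum_(i <- s) F i x = \sum_(i <- s) \int[mu]_x F i x.
Proof.
move=> iF; elim: s => [|i s [ih1 ih2]].
  rewrite big_nil; under eq_Rintegral do rewrite big_nil.
  under eq_fun do rewrite big_nil.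
  split; [exact: integrable0|by rewrite Rintegral_cst// mul0r].
rewrite big_cons -ih2 -RintegralD//; split.
  under eq_fun do rewrite big_cons.
  exact: (integrableD measurableT (iF i) ih1).
by apply: eq_Rintegral => x _; rewrite big_cons.
Qed.

(** * Velocity fields: gradient form, divergence and convection *)

Section velocity_theory.
Context (R : realType) (d : nat) (Omega : set 'rV[R]_d) (oOmega : open Omega).
Implicit Types u v w : vfield oOmega.
Local Notation vsp := (@velocity_space R d Omega oOmega).

Lemma grad_ip_linear (a : R) u v w :
  grad_ip (a *: u + v) w = a * grad_ip u w + grad_ip v w.
Proof.
rewrite /grad_ip mulr_sumr -big_split/=; apply: eq_bigr => i _.
rewrite mulr_sumr -big_split/=; apply: eq_bigr => j _.
exact: L2_ip_linear.
Qed.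

Lemma grad_ipC u v : grad_ip u v = grad_ip v u.
Proof. by apply: eq_bigr => i _; apply: eq_bigr => j _; exact: L2_ipC. Qed.

Lemma grad_ip_ge0 u : 0 <= grad_ip u u.
Proof. by apply: sumr_ge0 => i _; apply: sumr_ge0 => j _; exact: L2_ip_ge0. Qed.

Lemma grad_norm_ge0 u : 0 <= grad_norm u.
Proof. exact: sqrtr_ge0. Qed.

Lemma grad_norm_sqr u : grad_norm u ^+ 2 = grad_ip u u.
Proof. by rewrite sqr_sqrtr// grad_ip_ge0. Qed.

Lemma grad_normZ (a : R) u : grad_norm (a *: u) = `|a| * grad_norm u.
Proof. exact: (semi_ip_normZ grad_ip_linear grad_ipC). Qed.

Lemma H1_energy_le_grad u i : H1_energy (u i) <= grad_norm u ^+ 2.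
Proof.
rewrite grad_norm_sqr /grad_ip (bigD1 i)//= lerDl sumr_ge0// => j _.
by apply: sumr_ge0 => k _; exact: L2_ip_ge0.
Qed.

Lemma L2_ip_le_grad u i j : L2_ip (grad u i j) (grad u i j) <= grad_norm u ^+ 2.
Proof.
apply: le_trans (H1_energy_le_grad u i).
rewrite /H1_energy (bigD1 j)//= lerDl sumr_ge0// => k _; exact: L2_ip_ge0.
Qed.

Lemma divergence_linear (a : R) u v :
  divergence (a *: u + v) = a *: divergence u + divergence v.
Proof. by rewrite /divergence scaler_sumr -big_split. Qed.

(** The triangle inequality over the [d] diagonal entries of the gradient, each bounded by the full
    gradient norm. *)
Lemma divergence_le u :
  Num.sqrt (L2_ip (divergence u) (divergence u)) <= d%:R * grad_norm u.
Proof.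
have tri := semi_ip_triangle (@L2_ip_linear _ _ _ (dx oOmega)) (@L2_ipC _ _ _ _)
  (@L2_ip_ge0 _ _ _ _).
have -> : d%:R * grad_norm u = \sum_(i < d) grad_norm u.
  by rewrite sumr_const card_ord mulr_natl.
rewrite /divergence.
elim/big_ind2 : _ => [|x X y Y hx hy|i _].
- by have := semi_ip_normZ (@L2_ip_linear _ _ _ (dx oOmega)) (@L2_ipC _ _ _ _) 0 0;
    rewrite scale0r normr0 mul0r => ->.
- exact: le_trans (tri _ _) (lerD hx hy).
- by rewrite -[leRHS]ger0_norm ?grad_norm_ge0// -sqrtr_sqr ler_wsqrtr// L2_ip_le_grad.
Qed.

Hypothesis bOmega : bounded_set Omega.
Hypothesis hd : d = 2%N \/ d = 3%N.

(** A field stores its components and its gradient separately: the gradient vanishes by definiteness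
    of the L^2 product, the components by Poincare's inequality. *)
Lemma velocity_eq0 u : vsp u -> grad_norm u = 0 -> u = 0.
Proof.
move=> Vu u0; have [C C0 HC] := H10_sobolev oOmega bOmega hd.
have g0 i j : grad u i j = 0.
  apply: L2_ip_eq0; apply/eqP; rewrite eq_le L2_ip_ge0 andbT.
  by rewrite (le_trans (L2_ip_le_grad u i j))// u0 expr0n.
apply/funext => i; apply: injective_projections => /=; last first.
  by apply/funext => j; exact: g0.
apply: L2_ip_eq0; apply/eqP; rewrite eq_le L2_ip_ge0 andbT.
have [+ _ _] := HC _ (Vu i); move=> /le_trans; apply.
apply: (@le_trans _ _ (C * grad_norm u ^+ 2)); last by rewrite u0 expr0n mulr0.
by rewrite ler_wpM2l// H1_energy_le_grad.
Qed.

Lemma velocity_fourth u i : vsp u -> fourth_integrable (component u i).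
Proof.
move=> Vu; have [C _ HC] := H10_sobolev oOmega bOmega hd.
by have [] := HC _ (Vu i).
Qed.

(** Exchanging integral and sums is legitimate since each product is integrable, the components of
    [u] and [w] being in L^4. *)
Lemma convectionE u v w : vsp u -> vsp w ->
  convection u v w =
  \sum_i \sum_j triple (component u j) (grad v i j) (component w i).
Proof.
move=> Vu Vw; have uw i j := integrable_triple (grad v i j)
  (velocity_fourth j Vu) (velocity_fourth i Vw).
rewrite /convection; under eq_Rintegral do under eq_bigr do rewrite mulr_suml.
have sum_j i := Rintegral_sum (index_enum 'I_d) (fun j => uw i j).
rewrite (Rintegral_sum _ (fun i => (sum_j i).1)).2.
by apply: eq_bigr => i _; rewrite (sum_j i).2.
Qed.

Lemma convection_linear1 a u u' v w : vsp u -> vsp u' -> vsp (a *: u + u') ->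
  vsp w -> convection (a *: u + u') v w = a * convection u v w + convection u' v w.
Proof.
move=> Vu Vu' Vuu' Vw; rewrite !convectionE//.
rewrite mulr_sumr -big_split/=; apply: eq_bigr => i _.
rewrite mulr_sumr -big_split/=; apply: eq_bigr => j _.
by apply: triple_linear1; exact: velocity_fourth.
Qed.

Lemma convection_linear2 a u v v' w : vsp u -> vsp w ->
  convection u (a *: v + v') w = a * convection u v w + convection u v' w.
Proof.
move=> Vu Vw; rewrite !convectionE//.
rewrite mulr_sumr -big_split/=; apply: eq_bigr => i _.
rewrite mulr_sumr -big_split/=; apply: eq_bigr => j _.
by apply: triple_linear2; exact: velocity_fourth.
Qed.

Lemma convection_linear3 a u v w w' : vsp u -> vsp w -> vsp w' ->
  vsp (a *: w + w') ->
  convection u v (a *: w + w') = a * convection u v w + convection u v w'.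
Proof.
move=> Vu Vw Vw' Vww'; rewrite !convectionE//.
rewrite mulr_sumr -big_split/=; apply: eq_bigr => i _.
rewrite mulr_sumr -big_split/=; apply: eq_bigr => j _.
by apply: triple_linear3; exact: velocity_fourth.
Qed.

(** On unit balls [triple_le] and the L^4 embedding bound each of the [d * d] terms by
    [2^-1 + 4^-1 * C + 4^-1 * C]. *)
Lemma convection_bounded_on_balls : exists2 K : R, 0 <= K & forall u v w,
  vsp u -> vsp w -> grad_norm u <= 1 -> grad_norm v <= 1 -> grad_norm w <= 1 ->
  `|convection u v w| <= K.
Proof.
have [C C0 HC] := H10_sobolev oOmega bOmega hd.
exists (\sum_(i < d) \sum_(j < d) (2^-1 + 4^-1 * C + 4^-1 * C)).
  by apply: sumr_ge0 => i _; apply: sumr_ge0 => j _; rewrite !addr_ge0// mulr_ge0.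
move=> u v w Vu Vw u1 v1 w1; rewrite convectionE//.
have fourth_le z i : vsp z -> grad_norm z <= 1 ->
    \int[dx oOmega]_x (component z i x ^+ 4) <= C.
  move=> Vz z1; have [_ _ +] := HC _ (Vz i); move=> /le_trans; apply.
  rewrite ler_piMr// exprn_ile1 ?H1_energy_ge0//.
  by rewrite (le_trans (H1_energy_le_grad _ _))// exprn_ile1 ?grad_norm_ge0.
apply: le_trans (ler_norm_sum _ _ _) _; apply: ler_sum => i _.
apply: le_trans (ler_norm_sum _ _ _) _; apply: ler_sum => j _.
apply: le_trans (triple_le _ _ _) _; try exact: velocity_fourth.
apply: lerD; [apply: lerD|]; try by rewrite ler_wpM2l// fourth_le.
rewrite ler_piMr// (le_trans (L2_ip_le_grad _ _ _))//.
by rewrite exprn_ile1 ?grad_norm_ge0.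
Qed.

Section subspace.
Context (Xh : set (vfield oOmega)) (XhX : Xh `<=` vsp).
Hypothesis Xh_linear : forall a u v, Xh u -> Xh v -> Xh (a *: u + v).
Hypothesis Xh0 : Xh 0.

Let XhZ a u : Xh u -> Xh (a *: u).
Proof. by move=> Xu; rewrite -[a *: u]addr0; exact: Xh_linear. Qed.

Let N_eq0 u : Xh u -> grad_norm u = 0 -> u = 0.
Proof. by move=> /XhX; exact: velocity_eq0. Qed.

Let V0 : vsp 0.
Proof. exact: XhX. Qed.

Let conv0 u v w : Xh u -> Xh w ->
  [/\ convection 0 v w = 0, convection u 0 w = 0 & convection u v 0 = 0].
Proof.
move=> /XhX Vu /XhX Vw; split.
- have := @convection_linear1 (-1) 0 0 v w V0 V0.
  by rewrite scaler0 addr0 mulN1r addNr => ->.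
- have := @convection_linear2 (-1) u 0 0 w Vu Vw.
  by rewrite scaler0 addr0 mulN1r addNr => ->.
- have := @convection_linear3 (-1) u v 0 0 Vu V0 V0.
  by rewrite scaler0 addr0 mulN1r addNr => ->.
Qed.

Let convZ a u v w : Xh u -> Xh v -> Xh w ->
  [/\ convection (a *: u) v w = a * convection u v w,
   convection u (a *: v) w = a * convection u v w &
   convection u v (a *: w) = a * convection u v w].
Proof.
move=> Xu Xv Xw; have [c1 c2 c3] := conv0 v Xu Xw.
have Vu := XhX Xu; have Vw := XhX Xw.
split.
- by rewrite -[a *: u]addr0 convection_linear1 ?c1 ?addr0//; exact/XhX/XhZ.
- by rewrite -[a *: v]addr0 convection_linear2 ?c2 ?addr0.
- by rewrite -[a *: w]addr0 convection_linear3 ?c3 ?addr0//; exact/XhX/XhZ.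
Qed.

(** Homogeneity is used in [w], then in [v], then in [u], which leaves the bound on unit balls. *)
Lemma convection_bound : exists2 K : R, 0 <= K & forall u v w,
  Xh u -> Xh v -> Xh w ->
  `|convection u v w| <= K * grad_norm u * grad_norm v * grad_norm w.
Proof.
have [K K0 HK] := convection_bounded_on_balls; exists K => // u v w Xu Xv Xw.
have homog := homogeneous_le XhZ grad_normZ N_eq0 grad_norm_ge0.
apply: (homog (fun w => convection u v w)) Xw => [a z Xz|{}w Xw w1].
  by have [] := convZ a Xu Xv Xz.
apply: (homog (fun v => convection u v w)) Xv => [a z Xz|{}v Xv v1].
  by have [] := convZ a Xu Xz Xw.
apply: (homog (fun u => convection u v w)) Xu => [a z Xz|{}u Xu u1].
  by have [] := convZ a Xz Xv Xw.
by apply: HK => //; exact: XhX.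
Qed.

Lemma bstar_bound : exists2 K : R, 0 <= K & forall u v w,
  Xh u -> Xh v -> Xh w ->
  `|bstar u v w| <= K * grad_norm u * grad_norm v * grad_norm w.
Proof.
have [K K0 HK] := convection_bound; exists K => // u v w Xu Xv Xw.
rewrite /bstar; apply: le_trans (ler_normB _ _) _.
rewrite !normrM ger0_norm//.
have := HK u v w Xu Xv Xw; have := HK u w v Xu Xw Xv.
rewrite -[X in _ <= X -> _]mulrA [grad_norm w * grad_norm v]mulrC mulrA; lra.
Qed.

Lemma bstar_linear1 a u u' v w : Xh u -> Xh u' -> Xh v -> Xh w ->
  bstar (a *: u + u') v w = a * bstar u v w + bstar u' v w.
Proof.
move=> Xu Xu' Xv Xw; rewrite /bstar.
rewrite !convection_linear1//; try exact: XhX; try exact/XhX/Xh_linear.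
ring.
Qed.

Lemma bstar_linear2 a u v v' w : Xh u -> Xh v -> Xh v' -> Xh w ->
  bstar u (a *: v + v') w = a * bstar u v w + bstar u v' w.
Proof.
move=> Xu Xv Xv' Xw; rewrite /bstar convection_linear2 ?convection_linear3//;
  try exact: XhX; try exact/XhX/Xh_linear.
ring.
Qed.

Lemma bstarC u v w : bstar u w v = - bstar u v w.
Proof. by rewrite /bstar opprB. Qed.

Lemma bstar_linear3 a u v w w' : Xh u -> Xh v -> Xh w -> Xh w' ->
  bstar u v (a *: w + w') = a * bstar u v w + bstar u v w'.
Proof.
move=> Xu Xv Xw Xw'; rewrite bstarC bstar_linear2// bstarC (bstarC _ v w'); ring.
Qed.

End subspace.

End velocity_theory.

(** * The discrete problems *)

Section finite_dimensional.
Context (R : realType) (V : lmodType R) (E : set V) (hE : fin_dim_subspace E).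

Lemma fin_dim0 : E 0.
Proof.
have [n [e ->]] := hE; exists (fun=> 0) => //.
by apply: big1 => i _; rewrite scale0r.
Qed.

Lemma fin_dim_linear a u v : E u -> E v -> E (a *: u + v).
Proof.
have [n [e ->]] := hE; move=> [c _ <-] [c' _ <-].
exists (fun i => a * c i + c' i) => //.
rewrite scaler_sumr -big_split/=; apply: eq_bigr => i _.
by rewrite scalerDl scalerA.
Qed.

Lemma fin_dimB u v : E u -> E v -> E (u - v).
Proof. by move=> Eu Ev; rewrite addrC -scaleN1r; exact: fin_dim_linear. Qed.

Definition linear_on (F : V -> R) : Prop :=
  forall a u v, E u -> E v -> F (a *: u + v) = a * F u + F v.

Lemma linear_on0 F : linear_on F -> F 0 = 0.
Proof.
move=> linF; have := linF (-1) 0 0 fin_dim0 fin_dim0.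
by rewrite scaler0 addr0 mulN1r addNr.
Qed.

Lemma linear_on_sum F n (e : 'I_n -> V) (c : 'I_n -> R) : linear_on F ->
  (forall i, E (e i)) ->
  E (\sum_i c i *: e i) /\ F (\sum_i c i *: e i) = \sum_i c i * F (e i).
Proof.
move=> linF Ee; elim/big_rec2 : _ => [|i x y _ [Ey <-]].
  by split; [exact: fin_dim0|exact: linear_on0].
by split; [exact: fin_dim_linear|exact: linF].
Qed.

(* The hypothesis on [l] says that it vanishes on the kernel of the Gram matrix
   of any generating family, so that linear independence is never needed. *)
Lemma fin_dim_solve (a : V -> V -> R) (l : V -> R) :
  (forall v, E v -> linear_on (a^~ v)) -> (forall u, E u -> linear_on (a u)) ->
  linear_on l -> (forall w, E w -> a w w = 0 -> l w = 0) ->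
  exists2 U, E U & forall v, E v -> a U v = l v.
Proof.
move=> linl linr linL ker; have [n [e Ee]] := hE.
have Ei i : E (e i).
  rewrite Ee; exists (fun j => (j == i)%:R) => //.
  rewrite (bigD1 i)//= eqxx scale1r big1 ?addr0// => j /negPf ->.
  by rewrite scale0r.
pose A := \matrix_(i, j) a (e i) (e j).
pose b : 'rV_n := \row_j l (e j).
(* [b] lies in the row space of [A] as soon as it kills each column [y] of the cokernel. Such a [y]
   gives an element [w] with [a (e i) w = 0] for all [i], hence [a w w = 0], and the hypothesis
   yields [l w = 0]. *)
have bA : (b <= A)%MS.
  rewrite submxE; apply/eqP/rowP => k; rewrite [RHS]mxE mxE.
  pose y j := cokermx A j k.
  have [Ew lw] := linear_on_sum y linL Ei.
  under eq_bigr do rewrite [b _ _]mxE mulrC.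
  rewrite -lw; apply: ker => //.
  have [_ ->] := linear_on_sum y (linl _ Ew) Ei.
  apply: big1 => i _; have [_ ->] := linear_on_sum y (linr _ (Ei i)) Ei.
  have Ay : \sum_(j < n) y j * a (e i) (e j) = 0.
    have := congr1 (fun B : 'M[R]_n => B i k) (mulmx_coker A).
    rewrite /= [RHS]mxE [LHS]mxE => AK; rewrite -[RHS]AK.
    by apply: eq_bigr => j _; rewrite [A _ _]mxE mulrC.
  by rewrite Ay mulr0.
have /submxP[c bc] := bA.
pose U := \sum_i c ord0 i *: e i.
have UE v : E v -> a U v = \sum_i c ord0 i * a (e i) v.
  by move=> Ev; have [_ ->] := linear_on_sum (c ord0) (linl _ Ev) Ei.
have EU : E U by have [] := linear_on_sum (c ord0) linL Ei.
exists U => // v; rewrite {1}Ee => -[y _ <-].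
have [_ ->] := linear_on_sum y (linr _ EU) Ei.
have [_ ->] := linear_on_sum y linL Ei.
apply: eq_bigr => j _; rewrite UE//; congr (_ * _).
have := congr1 (fun B : 'rV[R]_n => B ord0 j) bc; rewrite /= [LHS]mxE [RHS]mxE => ->.
by apply: eq_bigr => i _; rewrite [A _ _]mxE.
Qed.

End finite_dimensional.

(** * The scheme as an Oseen problem followed by a pressure update *)

Section scheme.
Context (R : realType) (d : nat) (Omega : set 'rV[R]_d) (oOmega : open Omega).
Hypotheses (bOmega : bounded_set Omega) (hd : d = 2%N \/ d = 3%N).
Context (f : vfield oOmega -> R) (hf : velocity_dual f).
Context (Xh : set (vfield oOmega)) (hXh : fin_dim_subspace Xh).
Hypothesis XhX : Xh `<=` @velocity_space R d Omega oOmega.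
Context (Qh : set (L2 (dx oOmega))) (hQh : fin_dim_subspace Qh).
Context (nu rho alpha : R) (hnu : 0 < nu) (hrho : 0 < rho) (halpha : 0 < alpha).

Implicit Types (u v w : vfield oOmega) (p q r s : L2 (dx oOmega)) (x y z : state oOmega).

Local Notation H := (Hh Xh Qh).
Local Notation N := (Hh_norm alpha).
Local Notation ip := (@L2_ip _ _ R (dx oOmega)).
Local Notation G := (G nu rho alpha f Xh Qh).
Local Notation G' := (G' nu rho alpha f Xh Qh).

Definition L2_norm q : R := Num.sqrt (ip q q).

Lemma L2_norm_ge0 q : 0 <= L2_norm q. Proof. exact: sqrtr_ge0. Qed.

Lemma L2_norm_sqr q : L2_norm q ^+ 2 = ip q q.
Proof. by rewrite sqr_sqrtr// L2_ip_ge0. Qed.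

Lemma L2_ip_le p q : `|ip p q| <= L2_norm p * L2_norm q.
Proof.
exact: (semi_ip_cauchy_schwarz (@L2_ip_linear _ _ _ _) (@L2_ipC _ _ _ _)
  (@L2_ip_ge0 _ _ _ _)).
Qed.

Lemma grad_ip_le u v : `|grad_ip u v| <= grad_norm u * grad_norm v.
Proof.
exact: (semi_ip_cauchy_schwarz (@grad_ip_linear _ _ _ _) (@grad_ipC _ _ _ _)
  (@grad_ip_ge0 _ _ _ _)).
Qed.

Lemma L2_ipBl p q r : ip (p - q) r = ip p r - ip q r.
Proof. by rewrite addrC -scaleN1r L2_ip_linear mulN1r addrC. Qed.

Lemma grad_ipBl u v w : grad_ip (u - v) w = grad_ip u w - grad_ip v w.
Proof. by rewrite addrC -scaleN1r grad_ip_linear mulN1r addrC. Qed.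

Lemma divergenceB u v : divergence (u - v) = divergence u - divergence v.
Proof. by rewrite addrC -scaleN1r divergence_linear scaleN1r addrC. Qed.

Lemma L2_ip_linear_r (a : R) p q r : ip r (a *: p + q) = a * ip r p + ip r q.
Proof. by rewrite !(L2_ipC r) L2_ip_linear. Qed.

Lemma grad_ip_linear_r (a : R) u v w :
  grad_ip w (a *: u + v) = a * grad_ip w u + grad_ip w v.
Proof. by rewrite !(grad_ipC w) grad_ip_linear. Qed.

Let Xlin := fin_dim_linear hXh.

Definition oseen_form u U v : R := (rho^-1 + nu) * grad_ip U v + bstar u U v
  + rho / alpha * ip (divergence U) (divergence v).

(** The part of the right-hand side that is linear in the data: the previous iterate for [G], the
    direction for [G']. *)
Definition load y v : R := rho^-1 * grad_ip y.1 v + ip y.2 (divergence v).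

(** The second equation, common to [G] and [G'], where [s] is the old pressure. Once the velocity is
    known it determines the new one by a projection onto [Qh]. *)
Definition pressure_update s z : Prop := forall q, Qh q ->
  alpha * ip (z.2 - s) q + rho * ip (divergence z.1) q = 0.

Lemma pressure_update_linear a s s' z z' :
  pressure_update s z -> pressure_update s' z' ->
  pressure_update (a *: s + s') (a *: z + z').
Proof.
move=> pz pz' q Qq.
have := congr2 (fun A B => a * A + B) (pz q Qq) (pz' q Qq).
rewrite /= mulr0 addr0 divergence_linear !L2_ipBl !L2_ip_linear => <-.
move: (ip z.2 q) (ip z'.2 q) (ip s q) (ip s' q) (ip _ q) (ip _ q) => *; ring.
Qed.

Lemma pressure_updateB s s' z z' : pressure_update s z -> pressure_update s' z' ->
  pressure_update (s - s') (z - z').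
Proof.
move=> pz pz' q Qq.
have := congr2 (fun A B => A - B) (pz q Qq) (pz' q Qq).
rewrite /= subr0 divergenceB !L2_ipBl => <-.
move: (ip z.2 q) (ip z'.2 q) (ip s q) (ip s' q) (ip _ q) (ip _ q) => *; ring.
Qed.

Lemma G_equationsP x y : G_equations nu rho alpha f Xh Qh x y <->
  (forall v, Xh v -> oseen_form x.1 y.1 v = load x v + f v) /\ pressure_update x.2 y.
Proof.
rewrite /G_equations /oseen_form /load.
split=> -[e1 e2]; split=> // v Xv; have := e1 v Xv; rewrite grad_ipBl; lra.
Qed.

Lemma G'_equationsP x y z : G'_equations nu rho alpha f Xh Qh x y z <->
  (forall v, Xh v -> oseen_form x.1 z.1 v = load y v - bstar y.1 (G x).1 v) /\
  pressure_update y.2 z.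
Proof.
have rho0 : rho != 0 by rewrite gt_eqF.
have scaled v : grad_ip (z.1 - y.1) v + rho * nu * grad_ip z.1 v
     + rho * bstar x.1 z.1 v + rho * bstar y.1 (G x).1 v
     + rho ^+ 2 / alpha * ip (divergence z.1) (divergence v)
     - rho * ip y.2 (divergence v) =
   rho * (oseen_form x.1 z.1 v - (load y v - bstar y.1 (G x).1 v)).
  rewrite grad_ipBl /oseen_form /load.
  by field; rewrite rho0 gt_eqF.
rewrite /G'_equations; split=> -[e1 e2]; split=> // v Xv.
  have := e1 v Xv; rewrite scaled => /eqP.
  by rewrite mulf_eq0 (negPf rho0) subr_eq0 => /eqP.
by rewrite scaled e1// subrr mulr0.
Qed.

Lemma oseen_form_linear_l u v : Xh u -> Xh v ->
  linear_on Xh ((oseen_form u)^~ v).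
Proof.
move=> Xu Xv a U U' XU XU'; rewrite /oseen_form grad_ip_linear divergence_linear.
rewrite L2_ip_linear (bstar_linear2 bOmega hd XhX Xlin)//; ring.
Qed.

Lemma oseen_form_linear_r u U : Xh u -> Xh U -> linear_on Xh (oseen_form u U).
Proof.
move=> Xu XU a v v' Xv Xv'; rewrite /oseen_form grad_ip_linear_r divergence_linear.
rewrite L2_ip_linear_r (bstar_linear3 bOmega hd XhX Xlin)//; ring.
Qed.

Lemma oseen_formBl u U U' v : Xh u -> Xh U -> Xh U' -> Xh v ->
  oseen_form u (U - U') v = oseen_form u U v - oseen_form u U' v.
Proof.
move=> Xu XU XU' Xv; rewrite addrC -scaleN1r.
by rewrite (oseen_form_linear_l Xu Xv)// mulN1r addrC.
Qed.

Lemma bstarBl u u' v w : Xh u -> Xh u' -> Xh v -> Xh w ->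
  bstar (u - u') v w = bstar u v w - bstar u' v w.
Proof.
move=> Xu Xu' Xv Xw; rewrite addrC -scaleN1r.
by rewrite (bstar_linear1 bOmega hd XhX Xlin)// mulN1r addrC.
Qed.

Lemma bstarBr u v v' w : Xh u -> Xh v -> Xh v' -> Xh w ->
  bstar u (v - v') w = bstar u v w - bstar u v' w.
Proof.
move=> Xu Xv Xv' Xw; rewrite addrC -scaleN1r.
by rewrite (bstar_linear2 bOmega hd XhX Xlin)// mulN1r addrC.
Qed.

Lemma oseen_form_change u u' U v :
  oseen_form u U v = oseen_form u' U v + (bstar u U v - bstar u' U v).
Proof.
rewrite /oseen_form; move: (_ * grad_ip U v) (bstar u U v) (bstar u' U v).
by move: (rho / alpha * _) => p q r s; ring.
Qed.

Let k0 : 0 < rho^-1 + nu.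
Proof. by rewrite addr_gt0// invr_gt0. Qed.

Lemma oseen_coercive u U : (rho^-1 + nu) * grad_norm U ^+ 2 <= oseen_form u U U.
Proof.
rewrite grad_norm_sqr /oseen_form /bstar subrr addr0 lerDl.
by rewrite mulr_ge0 ?L2_ip_ge0// divr_ge0// ltW.
Qed.

Lemma oseen_le u U c : 0 <= c -> `|oseen_form u U U| <= c * grad_norm U ->
  (rho^-1 + nu) * grad_norm U <= c.
Proof.
move=> c0 h; have [->|U0] := eqVneq (grad_norm U) 0; first by rewrite mulr0.
have gU : 0 < grad_norm U by rewrite lt0r U0 grad_norm_ge0.
rewrite -(ler_pM2r gU) -mulrA -expr2.
exact: le_trans (oseen_coercive u U) (le_trans (ler_norm _) h).
Qed.

(** Test with [q = r] and bound the divergence by the gradient. Here [r] stands for a pressure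
    increment. *)
Lemma pressure_le r z : Qh r ->
  (forall q, Qh q -> alpha * ip r q + rho * ip (divergence z.1) q = 0) ->
  L2_norm r <= rho / alpha * d%:R * grad_norm z.1.
Proof.
move=> Qr e; have [->|r0] := eqVneq (L2_norm r) 0.
  by rewrite !mulr_ge0 ?grad_norm_ge0 ?invr_ge0// ltW.
have r_gt0 : 0 < L2_norm r by rewrite lt0r r0 L2_norm_ge0.
rewrite -(ler_pM2r r_gt0) -expr2 L2_norm_sqr.
have -> : ip r r = - (rho / alpha * ip (divergence z.1) r).
  apply: (mulfI (lt0r_neq0 halpha)); have := e r Qr => /eqP.
  rewrite addr_eq0 => /eqP ->; by field; rewrite gt_eqF.
apply: le_trans (ler_norm _) _; rewrite normrN normrM ger0_norm; last first.
  by rewrite divr_ge0// ltW.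
rewrite -!mulrA ler_wpM2l ?(ltW hrho)// ler_wpM2l ?invr_ge0 ?(ltW halpha)//.
apply: le_trans (L2_ip_le _ _) _; rewrite mulrA ler_wpM2r ?L2_norm_ge0//.
exact: divergence_le.
Qed.

Lemma Hh_norm_ge_grad x : grad_norm x.1 <= N x.
Proof.
rewrite -[leLHS]ger0_norm ?grad_norm_ge0// -sqrtr_sqr ler_wsqrtr// lerDl.
by rewrite mulr_ge0 ?L2_ip_ge0// ltW.
Qed.

Lemma Hh_norm_ge_pressure x : Num.sqrt alpha * L2_norm x.2 <= N x.
Proof.
rewrite -sqrtrM ?(ltW halpha)// ler_wsqrtr// lerDr.
exact: sqr_ge0.
Qed.

Lemma Hh_norm_ge0 x : 0 <= N x. Proof. exact: sqrtr_ge0. Qed.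

Lemma Hh_norm_le x : N x <= grad_norm x.1 + Num.sqrt alpha * L2_norm x.2.
Proof.
have g0 := grad_norm_ge0 x.1; have q0 := L2_norm_ge0 x.2.
have sq : 0 <= Num.sqrt alpha * L2_norm x.2 by rewrite mulr_ge0 ?sqrtr_ge0.
rewrite -[leRHS]ger0_norm ?addr_ge0// -sqrtr_sqr ler_wsqrtr// sqrrD.
rewrite exprMn [X in _ <= _ + X * _]sqr_sqrtr ?(ltW halpha)//.
rewrite L2_norm_sqr lerD2r lerDl.
by rewrite mulrn_wge0// mulr_ge0.
Qed.

Lemma Hh_norm_eq0 x : H x -> N x = 0 -> x = 0.
Proof.
move=> [Xx _] x0; apply: injective_projections.
  apply: velocity_eq0 => //; first exact: XhX.
  by apply/eqP; rewrite eq_le grad_norm_ge0 andbT -x0 Hh_norm_ge_grad.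
apply: L2_ip_eq0; rewrite -L2_norm_sqr; apply/eqP; rewrite sqrf_eq0 eq_le.
rewrite L2_norm_ge0 andbT -(ler_pM2l (_ : 0 < Num.sqrt alpha)) ?sqrtr_gt0//.
by rewrite mulr0 -x0 Hh_norm_ge_pressure.
Qed.

(** Coercivity bounds the velocity by [c / (rho^-1 + nu)]; the second summand of the numerator is
    the contribution of the pressure increment through [pressure_le]. *)
Definition stability_const : R :=
  (1 + Num.sqrt alpha * (rho / alpha * d%:R)) / (rho^-1 + nu).

Let pc0 : 0 <= rho / alpha * d%:R.
Proof. by rewrite mulr_ge0// divr_ge0// ltW. Qed.

Let stability_const_ge0 : 0 <= stability_const.
Proof. by rewrite divr_ge0 ?(ltW k0)// addr_ge0// mulr_ge0// sqrtr_ge0. Qed.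

Lemma solution_le u z r c : 0 <= c -> Xh z.1 -> Qh r ->
  `|oseen_form u z.1 z.1| <= c * grad_norm z.1 ->
  (forall q, Qh q -> alpha * ip r q + rho * ip (divergence z.1) q = 0) ->
  grad_norm z.1 + Num.sqrt alpha * L2_norm r <= stability_const * c.
Proof.
move=> c0 Xz Qr /(oseen_le c0) zc /(pressure_le Qr) rz.
have {}zc : grad_norm z.1 <= c / (rho^-1 + nu) by rewrite ler_pdivlMr// mulrC.
apply: (@le_trans _ _ ((1 + Num.sqrt alpha * (rho / alpha * d%:R)) * grad_norm z.1)).
  by rewrite mulrDl mul1r lerD2l -mulrA ler_wpM2l ?sqrtr_ge0.
rewrite /stability_const [leRHS]mulrAC -[leRHS]mulrA ler_wpM2l//.
by rewrite addr_ge0// mulr_ge0// sqrtr_ge0.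
Qed.

Lemma homogeneous_solution_le u z c : 0 <= c -> H z ->
  `|oseen_form u z.1 z.1| <= c * grad_norm z.1 -> pressure_update 0 z ->
  N z <= stability_const * c.
Proof.
move=> c0 [Xz Qz] oz pz; apply: le_trans (Hh_norm_le z) _.
by apply: (solution_le c0 Xz Qz oz) => q /pz; rewrite subr0.
Qed.

(** The system is triangular: first the velocity, then the pressure. By coercivity
    [oseen_form u w w = 0] forces the gradient norm of [w] to vanish, and the bound on [l] then
    gives [l w = 0], as [fin_dim_solve] requires. *)
Lemma oseen_solve u (l : vfield oOmega -> R) s c : Xh u -> Qh s ->
  linear_on Xh l -> (forall v, Xh v -> `|l v| <= c * grad_norm v) ->
  exists z, [/\ H z, forall v, Xh v -> oseen_form u z.1 v = l v &
    pressure_update s z].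
Proof.
move=> Xu Qs linl lc.
have kerl w : Xh w -> oseen_form u w w = 0 -> l w = 0.
  move=> Xw wE; have := oseen_coercive u w; rewrite wE => gw.
  have {}gw : grad_norm w = 0.
    apply/eqP; rewrite -sqrf_eq0 eq_le sqr_ge0 andbT.
    by rewrite -(ler_pM2l k0) mulr0.
  by apply/eqP; rewrite -normr_le0 (le_trans (lc _ Xw))// gw mulr0.
have [U XU UE] := fin_dim_solve hXh (fun v Xv => oseen_form_linear_l Xu Xv)
  (fun U XU => oseen_form_linear_r Xu XU) linl kerl.
pose lq q := ip s q - rho / alpha * ip (divergence U) q.
have linq : linear_on Qh lq.
  by move=> a q q' _ _; rewrite /lq !L2_ip_linear_r; ring.
have lin1 q : Qh q -> linear_on Qh (ip^~ q).
  by move=> _ a p p' _ _; exact: L2_ip_linear.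
have lin2 q : Qh q -> linear_on Qh (ip q).
  by move=> _ a p p' _ _; exact: L2_ip_linear_r.
have kerq r : Qh r -> ip r r = 0 -> lq r = 0.
  by move=> _ /L2_ip_eq0 ->; exact: (linear_on0 hQh linq).
have [P QP PE] := fin_dim_solve hQh lin1 lin2 linq kerq.
exists (U, P); split=> // q Qq /=; rewrite L2_ipBl PE// /lq.
by field; rewrite gt_eqF.
Qed.

(** The difference solves the homogeneous problem, whose stability estimate with [c = 0] makes its
    norm vanish. *)
Lemma oseen_unique u z z' s : Xh u -> H z -> H z' ->
  (forall v, Xh v -> oseen_form u z.1 v = oseen_form u z'.1 v) ->
  pressure_update s z -> pressure_update s z' -> z = z'.
Proof.
move=> Xu [Xz Qz] [Xz' Qz'] e p p'; apply/eqP; rewrite -subr_eq0; apply/eqP.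
have XB : Xh (z.1 - z'.1) by exact: fin_dimB.
have QB : Qh (z.2 - z'.2) by exact: fin_dimB.
apply: Hh_norm_eq0; first by split.
apply/eqP; rewrite eq_le Hh_norm_ge0 andbT.
have := @homogeneous_solution_le u (z - z') 0 (lexx _) (conj XB QB).
rewrite mulr0; apply.
  by rewrite oseen_formBl// e// subrr normr0 mul0r.
by rewrite -(subrr s); exact: (pressure_updateB p p').
Qed.

(** * Stability, Lipschitz and remainder estimates for [G] and [G'] *)

Section estimates.
Context (K : R) (K0 : 0 <= K).
Hypothesis bK : forall u v w, Xh u -> Xh v -> Xh w ->
  `|bstar u v w| <= K * grad_norm u * grad_norm v * grad_norm w.
Context (Cf : R) (Cf0 : 0 <= Cf).
Hypothesis fC : forall v, Xh v -> `|f v| <= Cf * grad_norm v.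
Hypothesis f_linear : linear_on Xh f.

Definition load_const : R := rho^-1 + d%:R / Num.sqrt alpha.

Let sa0 : 0 < Num.sqrt alpha. Proof. by rewrite sqrtr_gt0. Qed.

Let load_const_ge0 : 0 <= load_const.
Proof. by rewrite addr_ge0 ?divr_ge0 ?invr_ge0// ltW. Qed.

Let Hlin a x y : H x -> H y -> H (a *: x + y).
Proof.
by move=> [Xx Qx] [Xy Qy]; split; [exact: Xlin|exact: (fin_dim_linear hQh)].
Qed.

Let HB x y : H x -> H y -> H (x - y).
Proof. by move=> [Xx Qx] [Xy Qy]; split; exact: fin_dimB. Qed.

Let HD x y : H x -> H y -> H (x + y).
Proof. by move=> Hx Hy; rewrite -[x]scale1r; exact: Hlin. Qed.

Lemma load_le y v : `|load y v| <= load_const * N y * grad_norm v.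
Proof.
rewrite /load /load_const mulrDl mulrDl; apply: le_trans (ler_normD _ _) _.
have gv := grad_norm_ge0 v; apply: lerD.
  rewrite normrM ger0_norm ?invr_ge0 ?(ltW hrho)// -mulrA.
  rewrite ler_wpM2l ?invr_ge0 ?(ltW hrho)//.
  by apply: le_trans (grad_ip_le _ _) _; rewrite ler_wpM2r ?Hh_norm_ge_grad.
apply: le_trans (L2_ip_le _ _) _.
apply: (@le_trans _ _ (L2_norm y.2 * (d%:R * grad_norm v))).
  by rewrite ler_wpM2l ?L2_norm_ge0// divergence_le.
rewrite mulrCA -!mulrA ler_wpM2l// mulrA ler_wpM2r//.
by rewrite ler_pdivlMl// Hh_norm_ge_pressure.
Qed.

Lemma load_linear y : linear_on Xh (load y).
Proof.
move=> a u v _ _; rewrite /load grad_ip_linear_r divergence_linear L2_ip_linear_r.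
ring.
Qed.

Lemma load_linear_l a y y' v : load (a *: y + y') v = a * load y v + load y' v.
Proof. by rewrite /load grad_ip_linear L2_ip_linear; ring. Qed.

Lemma loadB y y' v : load (y - y') v = load y v - load y' v.
Proof. by rewrite addrC -scaleN1r load_linear_l mulN1r addrC. Qed.

(** Since [oseen_solve] provides a solution, [xget] returns a solution and not its default value. *)
Lemma G_spec x : H x -> [/\ H (G x),
  forall v, Xh v -> oseen_form x.1 (G x).1 v = load x v + f v &
  pressure_update x.2 (G x)].
Proof.
move=> [Xx Qx].
have lin : linear_on Xh (fun v => load x v + f v).
  by move=> a u v Xu Xv; rewrite load_linear// f_linear//; ring.
have bound v : Xh v -> `|load x v + f v| <= (load_const * N x + Cf) * grad_norm v.
  move=> Xv; rewrite mulrDl; apply: le_trans (ler_normD _ _) _.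
  by rewrite lerD ?load_le ?fC.
have [z [Hz oz pz]] := oseen_solve Xx Qx lin bound.
have Sz : [set y | H y /\ G_equations nu rho alpha f Xh Qh x y] z.
  by split => //; apply/G_equationsP.
by have [HG /G_equationsP[]] := xgetPex 0 (ex_intro _ z Sz).
Qed.

Lemma G'_spec x y : H x -> H y -> [/\ H (G' x y),
  forall v, Xh v -> oseen_form x.1 (G' x y).1 v = load y v - bstar y.1 (G x).1 v &
  pressure_update y.2 (G' x y)].
Proof.
move=> Hx [Xy Qy]; have [[XG _] _ _] := G_spec Hx.
have lin : linear_on Xh (fun v => load y v - bstar y.1 (G x).1 v).
  move=> a u v Xu Xv; rewrite load_linear// (bstar_linear3 bOmega hd XhX Xlin)//.
  ring.
have bound v : Xh v -> `|load y v - bstar y.1 (G x).1 v| <=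
    (load_const * N y + K * grad_norm y.1 * grad_norm (G x).1) * grad_norm v.
  move=> Xv; rewrite mulrDl; apply: le_trans (ler_normB _ _) _.
  by rewrite lerD ?load_le ?bK.
have [z [Hz oz pz]] := oseen_solve Hx.1 Qy lin bound.
have Sz : [set z | H z /\ G'_equations nu rho alpha f Xh Qh x y z] z.
  by split => //; apply/G'_equationsP.
by have [HG /G'_equationsP[]] := xgetPex 0 (ex_intro _ z Sz).
Qed.

Lemma G_velocity_le x : H x ->
  (rho^-1 + nu) * grad_norm (G x).1 <= load_const * N x + Cf.
Proof.
move=> Hx; have [[XG _] oG _] := G_spec Hx.
apply: (@oseen_le x.1); first by rewrite addr_ge0// mulr_ge0 ?Hh_norm_ge0.
rewrite oG// mulrDl; apply: le_trans (ler_normD _ _) _.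
by rewrite lerD ?load_le ?fC.
Qed.

(** The stability estimate controls the pressure of the solution minus that of the data; the summand
    1 pays for the latter. *)
Definition increment_const (B : R) : R := stability_const * (load_const + K * B) + 1.

Let increment_const_ge0 B : 0 <= B -> 0 <= increment_const B.
Proof. by move=> B0; rewrite addr_ge0// mulr_ge0// addr_ge0// mulr_ge0. Qed.

Let increment_const_le B B' : B <= B' -> increment_const B <= increment_const B'.
Proof. by move=> BB'; rewrite lerD2r ler_wpM2l// lerD2l ler_wpM2l. Qed.

(* Common to the bound on [G' x y] and to the Lipschitz estimate for [G]: both
   increments solve the same linearized system with data [y]. *)
Lemma linearized_le u v y z B : H y -> H z -> 0 <= B -> grad_norm v <= B ->
  Xh v -> oseen_form u z.1 z.1 = load y z.1 - bstar y.1 v z.1 ->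
  pressure_update y.2 z -> N z <= increment_const B * N y.
Proof.
move=> [Xy Qy] [Xz Qz] B0 vB Xv oz pz.
have Ny := Hh_norm_ge0 y; have gz := grad_norm_ge0 z.1.
have gy := grad_norm_ge0 y.1; have gv := grad_norm_ge0 v.
have c0 : 0 <= (load_const + K * B) * N y by rewrite mulr_ge0// addr_ge0// mulr_ge0.
have Qr : Qh (z.2 - y.2) by exact: fin_dimB.
have oc : `|oseen_form u z.1 z.1| <= (load_const + K * B) * N y * grad_norm z.1.
  rewrite oz; apply: le_trans (ler_normB _ _) _.
  rewrite mulrDl mulrDl lerD ?load_le//; apply: le_trans (bK Xy Xv Xz) _.
  rewrite ler_wpM2r// -!mulrA ler_wpM2l// mulrC ler_pM//.
  exact: Hh_norm_ge_grad.
have := solution_le c0 Xz Qr oc pz; rewrite mulrA => S.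
have zr : L2_norm z.2 <= L2_norm (z.2 - y.2) + L2_norm y.2.
  have := semi_ip_triangle (@L2_ip_linear _ _ _ (dx oOmega)) (@L2_ipC _ _ _ _)
    (@L2_ip_ge0 _ _ _ _) (z.2 - y.2) y.2.
  by rewrite subrK.
apply: le_trans (Hh_norm_le z) _; rewrite /increment_const mulrDl mul1r.
apply: (@le_trans _ _ (grad_norm z.1 + Num.sqrt alpha * L2_norm (z.2 - y.2)
    + Num.sqrt alpha * L2_norm y.2)).
  by rewrite -addrA lerD2l -mulrDr ler_wpM2l ?sqrtr_ge0.
by rewrite lerD// Hh_norm_ge_pressure.
Qed.

Lemma G'_bound x y : H x -> H y ->
  N (G' x y) <= increment_const (grad_norm (G x).1) * N y.
Proof.
move=> Hx Hy; have [[XG QG] _ _] := G_spec Hx; have [HG' oG' pG'] := G'_spec Hx Hy.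
apply: (linearized_le (u := x.1) Hy HG' (grad_norm_ge0 _) (lexx _) XG) => //.
by rewrite oG'//; case: HG'.
Qed.

(** Subtracting the two problems cancels [f]; the difference solves the linearized system at [x]
    with data [x - x'] and transported velocity [(G x').1]. The constant therefore involves one of
    the two states only. *)
Lemma G_lipschitz x x' : H x -> H x' ->
  N (G x - G x') <= increment_const (grad_norm (G x').1) * N (x - x').
Proof.
move=> Hx Hx'; have [HG oG pG] := G_spec Hx; have [HG' oG' pG'] := G_spec Hx'.
have [[Xx Qx] [Xx' Qx'] [XG QG] [XG' QG']] := And4 Hx Hx' HG HG'.
have XB : Xh ((G x).1 - (G x').1) by exact: fin_dimB.
apply: (linearized_le (u := x.1) (HB Hx Hx') (HB HG HG') (grad_norm_ge0 _) (lexx _) XG').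
  rewrite [(G x - G x').1]/= [(x - x').1]/= oseen_formBl// oG// loadB bstarBl//.
  rewrite (oseen_form_change x.1 x'.1) oG'//.
  move: (load x _) (load x' _) (f _) (bstar x.1 _ _) (bstar x'.1 _ _).
  by move=> *; ring.
exact: (pressure_updateB pG pG').
Qed.

Lemma G'_lipschitz x x' y : H x -> H x' -> H y ->
  N (G' x y - G' x' y) <=
  2 * stability_const * K * increment_const (grad_norm (G x').1) * N (x - x') * N y.
Proof.
move=> Hx Hx' Hy; have [HGx _ _] := G_spec Hx; have [HGx' _ _] := G_spec Hx'.
have [HG oG pG] := G'_spec Hx Hy; have [HG' oG' pG'] := G'_spec Hx' Hy.
have NG := G_lipschitz Hx Hx'; have NG' := G'_bound Hx' Hy.
have Nx := Hh_norm_ge0 (x - x'); have Ny := Hh_norm_ge0 y.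
have := increment_const_ge0 (grad_norm_ge0 (G x').1).
move: (increment_const _) NG NG' => g NG NG' g0.
move: (G' x y) (G' x' y) HG oG pG HG' oG' pG' NG' => D D' hD oD pD hD' oD' pD' ND'.
move: (G x) (G x') HGx HGx' NG oD oD' => W W' HW HW' NW oD oD'.
have [Xx Xx' Xy XW XW'] : [/\ Xh x.1, Xh x'.1, Xh y.1, Xh W.1 & Xh W'.1].
  by split; [case: Hx|case: Hx'|case: Hy|case: HW|case: HW'].
have [XD XD'] : Xh D.1 /\ Xh D'.1 by split; [case: hD|case: hD'].
have XB : Xh (D.1 - D'.1) by exact: fin_dimB.
set Z := D.1 - D'.1 in XB; have gZ := grad_norm_ge0 Z.
have oZ : oseen_form x.1 Z Z = - bstar (x.1 - x'.1) D'.1 Z - bstar y.1 (W.1 - W'.1) Z.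
  rewrite (oseen_formBl Xx XD XD' XB) (oD _ XB) (bstarBl Xx Xx' XD' XB).
  rewrite (bstarBr Xy XW XW' XB) (oseen_form_change x.1 x'.1) (oD' _ XB).
  move: (load _ _) (bstar x.1 _ _) (bstar x'.1 _ _) (bstar _ W.1 _) (bstar _ W'.1 _).
  by move=> *; ring.
have b1 : `|bstar (x.1 - x'.1) D'.1 Z| <= K * N (x - x') * (g * N y) * grad_norm Z.
  apply: le_trans (bK _ XD' XB) _; first exact: fin_dimB.
  rewrite ler_wpM2r// ler_pM ?mulr_ge0 ?grad_norm_ge0//.
    by rewrite ler_wpM2l// (Hh_norm_ge_grad (x - x')).
  exact: le_trans (Hh_norm_ge_grad _) ND'.
have b2 : `|bstar y.1 (W.1 - W'.1) Z| <= K * N y * (g * N (x - x')) * grad_norm Z.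
  apply: le_trans (bK Xy _ XB) _; first exact: fin_dimB.
  rewrite ler_wpM2r// ler_pM ?mulr_ge0 ?grad_norm_ge0//.
    by rewrite ler_wpM2l// Hh_norm_ge_grad.
  exact: le_trans (Hh_norm_ge_grad (W - W')) NW.
have bound : `|oseen_form x.1 Z Z| <= 2 * K * g * N (x - x') * N y * grad_norm Z.
  rewrite oZ; apply: le_trans (ler_normB _ _) _; rewrite normrN.
  apply: le_trans (lerD b1 b2) _.
  move: (N (x - x')) (N y) (grad_norm Z) => a b c.
  by rewrite le_eqVlt; apply/orP; left; apply/eqP; ring.
have c0 : 0 <= 2 * K * g * N (x - x') * N y by rewrite !mulr_ge0.
have pZ : pressure_update 0 (D - D').
  by rewrite -(subrr y.2); exact: (pressure_updateB pD pD').
apply: le_trans (homogeneous_solution_le c0 (HB hD hD') bound pZ) _.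
move: (stability_const) (N (x - x')) (N y) => a b c.
by rewrite le_eqVlt; apply/orP; left; apply/eqP; ring.
Qed.

(** All terms of order 0 and 1 in [y] cancel: the remainder solves an Oseen problem at [x] with
    right-hand side [- bstar y.1 (G (x + y) - G x).1 v], which is quadratic in [y] by
    [G_lipschitz]. *)
Lemma G_remainder x y : H x -> H y ->
  N (G (x + y) - G x - G' x y) <=
  stability_const * K * increment_const (grad_norm (G x).1) * N y * N y.
Proof.
move=> Hx Hy; have Hxy := HD Hx Hy.
have [HGx oG pG] := G_spec Hx; have [HGxy oGy pGy] := G_spec Hxy.
have [HG' oG' pG'] := G'_spec Hx Hy.
have NG := G_lipschitz Hxy Hx; rewrite addrAC subrr add0r in NG.
have Ny := Hh_norm_ge0 y; have := increment_const_ge0 (grad_norm_ge0 (G x).1).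
move: (increment_const _) NG => g NG g0.
move: (G' x y) HG' oG' pG' => D hD oD pD.
move: (G x) (G (x + y)) HGx HGxy NG oG pG oGy pGy oD => W W' HW HW' NW oW pW oW' pW' oD.
have [Xx Xy XW XW' XD] : [/\ Xh x.1, Xh y.1, Xh W.1, Xh W'.1 & Xh D.1].
  by split; [case: Hx|case: Hy|case: HW|case: HW'|case: hD].
have XB : Xh (W'.1 - W.1) by exact: fin_dimB.
have XBB : Xh (W'.1 - W.1 - D.1) by exact: fin_dimB.
set Z := W'.1 - W.1 - D.1 in XBB.
have oZ : oseen_form x.1 Z Z = - bstar y.1 (W'.1 - W.1) Z.
  rewrite (oseen_formBl Xx XB XD XBB) (oseen_formBl Xx XW' XW XBB).
  rewrite (oW _ XBB) (oD _ XBB) (bstarBr Xy XW' XW XBB).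
  rewrite (oseen_form_change x.1 (x + y).1) (oW' _ XBB).
  have -> : load (x + y) Z = load x Z + load y Z.
    by have := load_linear_l 1 x y Z; rewrite scale1r mul1r.
  have -> : bstar (x + y).1 W'.1 Z = bstar x.1 W'.1 Z + bstar y.1 W'.1 Z.
    have := bstar_linear1 bOmega hd XhX Xlin 1 Xx Xy XW' XBB.
    by rewrite scale1r mul1r.
  move: (load x _) (load y _) (f _) (bstar x.1 _ _) (bstar y.1 W'.1 _) (bstar y.1 W.1 _).
  by move=> *; ring.
have bound : `|oseen_form x.1 Z Z| <= K * g * N y * N y * grad_norm Z.
  rewrite oZ normrN; apply: le_trans (bK Xy XB XBB) _.
  rewrite ler_wpM2r ?grad_norm_ge0//.
  have -> : K * g * N y * N y = K * N y * (g * N y).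
    by move: (N y) => b; ring.
  rewrite ler_pM ?mulr_ge0 ?grad_norm_ge0//.
    by rewrite ler_wpM2l// Hh_norm_ge_grad.
  exact: le_trans (Hh_norm_ge_grad (W' - W)) NW.
have c0 : 0 <= K * g * N y * N y by rewrite !mulr_ge0.
(* The old pressures of the three problems are those of [x + y], [x] and [y], and cancel. *)
have pZ : pressure_update 0 (W' - W - D).
  have -> : 0 = (x + y).2 - x.2 - y.2 by rewrite /= [x.2 + _]addrC addrK subrr.
  exact: (pressure_updateB (pressure_updateB pW' pW) pD).
apply: le_trans (homogeneous_solution_le c0 (HB (HB HW' HW) hD) bound pZ) _.
move: (stability_const) (N y) => a b.
by rewrite le_eqVlt; apply/orP; left; apply/eqP; ring.
Qed.

(** Both sides solve the same Oseen problem, so uniqueness applies. *)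
Lemma G'_linear x (a : R) y z : H x -> H y -> H z ->
  G' x (a *: y + z) = a *: G' x y + G' x z.
Proof.
move=> Hx Hy Hz; have Hyz := Hlin a Hy Hz; have [[XGx _] _ _] := G_spec Hx.
have [HG oG pG] := G'_spec Hx Hyz.
have [HG1 oG1 pG1] := G'_spec Hx Hy; have [HG2 oG2 pG2] := G'_spec Hx Hz.
move: (G' x _) (G' x y) (G' x z) HG oG pG HG1 oG1 pG1 HG2 oG2 pG2.
move: (G x) XGx => W XW D D1 D2 HG oG pG HG1 oG1 pG1 HG2 oG2 pG2.
apply: (oseen_unique Hx.1 HG (Hlin a HG1 HG2)) _ pG _ => [v Xv|].
  rewrite oG// (oseen_form_linear_l Hx.1 Xv)//; last 2 first.
  - by case: HG1.
  - by case: HG2.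
  rewrite oG1// oG2// load_linear_l (bstar_linear1 bOmega hd XhX Xlin)//; last 2 first.
  - by case: Hy.
  - by case: Hz.
  ring.
exact: (pressure_update_linear a pG1 pG2).
Qed.

Let skK0 : 0 <= stability_const * K. Proof. exact: mulr_ge0. Qed.

Let sk2K0 : 0 <= 2 * stability_const * K.
Proof. by rewrite -mulrA; apply: mulr_ge0. Qed.

(** On the ball of radius [M], [G_velocity_le] bounds the gradient of the velocity of [G x]
    uniformly, which makes the constants of [G'_bound] and [G'_lipschitz] uniform. *)
Lemma G'_local_estimates M : exists C0 C1 : R, [/\ 0 < C0, 0 < C1,
  forall x y, H x -> N x <= M -> H y -> N (G' x y) <= C0 * N y &
  forall x x' y, H x -> N x <= M -> H x' -> N x' <= M -> H y ->
    N (G' x y - G' x' y) <= C1 * N (x - x') * N y].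
Proof.
(* The absolute value keeps [B] nonnegative whatever the sign of [M]. *)
pose B := `|(load_const * M + Cf) / (rho^-1 + nu)|.
have GB x : H x -> N x <= M -> increment_const (grad_norm (G x).1) <= increment_const B.
  move=> Hx xM; apply: increment_const_le; apply: le_trans (ler_norm _).
  rewrite ler_pdivlMr// mulrC; apply: le_trans (G_velocity_le Hx) _.
  by rewrite lerD2r ler_wpM2l.
have C0 : 0 < increment_const B.
  by rewrite ltr_wpDl// mulr_ge0// addr_ge0// mulr_ge0 ?normr_ge0.
have C1 : 0 <= 2 * stability_const * K * increment_const B.
  by apply: mulr_ge0 (ltW C0).
(* The added 1 makes the second constant positive even if [K = 0]. *)
exists (increment_const B), (2 * stability_const * K * increment_const B + 1).
split=> // [|x y Hx xM Hy|x x' y Hx xM Hx' x'M Hy].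
- by rewrite ltr_wpDl.
- apply: le_trans (G'_bound Hx Hy) _.
  by rewrite ler_wpM2r ?Hh_norm_ge0// GB.
- apply: le_trans (G'_lipschitz Hx Hx' Hy) _.
  rewrite ler_wpM2r ?Hh_norm_ge0// ler_wpM2r ?Hh_norm_ge0//.
  by rewrite ler_wpDr// ler_wpM2l ?GB.
Qed.

(** The remainder is at most [c * N y * N y], so the radius [e / (c + 1)] suffices, where [c + 1] is
    positive even if [c = 0]. Continuity of the derivative follows in the same way from
    [G'_lipschitz]. *)
Lemma G_continuously_differentiable : continuously_frechet_differentiable H N G G'.
Proof.
split=> x Hx; last first.
  move=> e e0; pose c := 2 * stability_const * K * increment_const (grad_norm (G x).1).
  have c0 : 0 <= c by apply: mulr_ge0 => //; exact/increment_const_ge0/grad_norm_ge0.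
  have c1 : 0 < c + 1 by rewrite ltr_wpDl.
  exists (e / (c + 1)); first exact: divr_gt0.
  move=> z Hz zx y Hy; apply: le_trans (G'_lipschitz Hz Hx Hy) _.
  rewrite ler_wpM2r ?Hh_norm_ge0//; move/ltW: zx; rewrite ler_pdivlMr// mulrC.
  apply: le_trans; rewrite ler_wpM2r ?Hh_norm_ge0// -/c.
  by rewrite lerDl.
split.
  split=> [y Hy|a y z Hy Hz|].
  - by have [] := G'_spec Hx Hy.
  - exact: G'_linear.
  - by exists (increment_const (grad_norm (G x).1)) => y Hy; exact: G'_bound.
move=> e e0; pose c := stability_const * K * increment_const (grad_norm (G x).1).
have c0 : 0 <= c by apply: mulr_ge0 => //; exact/increment_const_ge0/grad_norm_ge0.
have c1 : 0 < c + 1 by rewrite ltr_wpDl.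
exists (e / (c + 1)); first exact: divr_gt0.
move=> y Hy ye; apply: le_trans (G_remainder Hx Hy) _.
rewrite ler_wpM2r ?Hh_norm_ge0//; move/ltW: ye; rewrite ler_pdivlMr// mulrC.
apply: le_trans; rewrite ler_wpM2r ?Hh_norm_ge0// -/c.
by rewrite lerDl.
Qed.

End estimates.

End scheme.

(** * Conclusion on a bounded neighbourhood of the fixed point *)

Unset Implicit Arguments.

Theorem proposition3p1 (R : realType) (d : nat) (hd : d = 2%N \/ d = 3%N)
  (Omega : set 'rV[R]_d) (oOmega : open Omega)
  (hdom : bounded_domain Omega) (hlip : lipschitz_boundary Omega)
  (f : vfield oOmega -> R) (hf : velocity_dual f)
  (Xh : set (vfield oOmega)) (hXh : fin_dim_subspace Xh)
  (hXhX : Xh `<=` @velocity_space R d Omega oOmega)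
  (Qh : set (L2 (dx oOmega))) (hQh : fin_dim_subspace Qh)
  (hQhQ : Qh `<=` @pressure_space R d Omega oOmega)
  (nu rho alpha : R) (hnu : 0 < nu) (hrho : 0 < rho) (halpha : 0 < alpha)
  (hcond1 : 3 * d%:R / 2 * rho ^+ 2 < alpha)
  (hcond2 : d%:R * rho ^+ 2 / (1 + 2 * rho * nu) < alpha)
  (xs : state oOmega) (hxs : Hh Xh Qh xs)
  (hfix : G nu rho alpha f Xh Qh xs = xs)
  (U : set (state oOmega))
  (hU : bounded_neighborhood (Hh Xh Qh) (Hh_norm alpha) xs U) :
  (exists C0 C1 : R,
    [/\ 0 < C0, 0 < C1,
        forall x y, U x -> Hh Xh Qh y ->
          Hh_norm alpha (G' nu rho alpha f Xh Qh x y)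
          <= C0 * Hh_norm alpha y &
        forall x x' y, U x -> U x' -> Hh Xh Qh y ->
          Hh_norm alpha (G' nu rho alpha f Xh Qh x y
                         - G' nu rho alpha f Xh Qh x' y)
          <= C1 * Hh_norm alpha (x - x') * Hh_norm alpha y]) /\
  continuously_frechet_differentiable (Hh Xh Qh) (Hh_norm alpha)
    (G nu rho alpha f Xh Qh) (G' nu rho alpha f Xh Qh) /\
  G nu rho alpha f Xh Qh xs = xs.
Proof.
have [_ _ bO] := hdom.
have [K K0 bK] := bstar_bound bO hd hXhX (fin_dim_linear hXh) (fin_dim0 hXh).
have [f_lin [C fC]] := hf.
(* The continuity constant of [f] comes without a sign; its absolute value is a continuity constant
   as well. *)
have Cf0 : 0 <= `|C| by [].
have fCf v : Xh v -> `|f v| <= `|C| * grad_norm v.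
  move=> Xv; apply: le_trans (fC v (hXhX v Xv)) _.
  by rewrite ler_wpM2r ?grad_norm_ge0// ler_norm.
have f_linX : linear_on Xh f.
  by move=> a u v Xu Xv; apply: f_lin; exact: hXhX.
split; last first.
  split=> //; exact: (G_continuously_differentiable bO hd hXh hXhX hQh hnu hrho
    halpha K0 bK fCf f_linX).
(* A bound [M] for the norm on [U] reduces both estimates to the ball of radius [M]. *)
have [UH _ [M UM]] := hU.
have [C0 [C1 [C00 C10 b0 b1]]] := G'_local_estimates bO hd hXh hXhX hQh hnu hrho
  halpha K0 bK Cf0 fCf f_linX M.
exists C0, C1; split=> // [x y Ux Hy|x x' y Ux Ux' Hy].
  by apply: b0 => //; [exact: UH|exact: UM].
by apply: b1 => //; [exact: UH|exact: UM|exact: UH|exact: UM].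
Qed.
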